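(* Let $\{\varepsilon_k\}_{k\in\mathbb{Z}}$ be i.i.d. random functions in $\mathcal{C}[0,1]$, let $\delta\in\mathcal{C}[0,1]^+$, and let $\beta:\mathcal{C}[0,1]^+\to\mathcal{C}[0,1]^+$ be a non-negative kernel operator, $\beta(x)(t)=\int\beta(t,s)x(s)\,ds$. Define $$H(\varepsilon_1^2)=\sup_{0\le t\le1}\int\beta(t,s)\varepsilon_1^2(s)\,ds.$$ If there is some $\alpha>0$ such that $E\{H(\varepsilon_1^2)\}^\alpha<1$, then the functional ARCH(1) equations $$y_k=\varepsilon_k\sigma_k,\qquad \sigma_k^2=\delta+\beta(y_{k-1}^2),\qquad k\in\mathbb{Z},$$ have a unique strictly stationary solution in $\mathcal{C}[0,1]$. Furthermore, $\sigma_k^2=g(\varepsilon_{k-1},\varepsilon_{k-2},\ldots)$ with some measurable functional $g:\mathcal{C}[0,1]^{\mathbb{N}}\to\mathcal{C}[0,1]$. In addition, if $\{\varepsilon_k'\}$ is an independent copy of $\{\varepsilon_k\}$ and, for $m\ge 1$, $$\sigma_{km}^2=g(\varepsilon_{k-1},\ldots,\varepsilon_{k-m},\varepsilon_{k-m-1}',\varepsilon_{k-m-2}',\ldots),$$ then, with some $0<r=r(\alpha)<1$ and $c=c(\alpha)<\infty$, $$E\{\|\sigma_k^2-\sigma_{km}^2\|_\infty\}^\alpha\le c\,r^m\qquad\text{for all }k\in\mathbb{Z},\ m\ge1.$$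
   Context: All integrals are over $[0,1]$. $\mathcal{C}[0,1]$ is the space of real continuous functions on $[0,1]$ with the sup-norm $\|x\|_\infty=\sup_{t\in[0,1]}|x(t)|$; $\mathcal{C}[0,1]^+$ is its subset of non-negative functions. Products, squares and square roots are pointwise. The same symbol $\beta$ denotes the kernel and the operator. A solution in $\mathcal{C}[0,1]$ is a $\mathcal{C}[0,1]$-valued process $\{y_k\}_{k\in\mathbb{Z}}$ together with $\mathcal{C}[0,1]^+$-valued $\{\sigma_k^2\}_{k\in\mathbb{Z}}$, $\sigma_k\ge0$ the pointwise square root, satisfying the two equations almost surely. Strictly stationary means that the joint law is invariant under shifts of $k$; uniqueness is up to almost sure equality, for the given sequence $\{\varepsilon_k\}$. *)

(* Defs.v *)
From HB Require Import structures.
From mathcomp Require Import all_boot all_order all_algebra.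
From mathcomp Require Import all_classical all_reals all_analysis.
Import Order.TTheory GRing.Theory Num.Theory numFieldNormedType.Exports.

Set Implicit Arguments.
Unset Strict Implicit.
Unset Printing Implicit Defensive.

Local Open Scope classical_set_scope.
Local Open Scope ring_scope.

(* An element of C[0,1] is represented by its extension by 0 to the whole line,
   so that Leibniz equality on [C01 R] is equality of functions on [0,1]. *)
Record C01 (R : realType) := MkC01 {
  C01_fun :> R -> R ;
  C01_continuous : {within `[0, 1], continuous C01_fun} ;
  C01_out : forall t : R, t \notin `[0, 1] -> C01_fun t = 0 }.

Record C01p (R : realType) := MkC01p {
  C01p_val :> C01 R ;
  C01p_ge0 : forall t : R, t \in `[0, 1] -> 0 <= C01p_val t }.

Section space.
Variable R : realType.

HB.instance Definition _ := gen_eqMixin (C01 R).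
HB.instance Definition _ := gen_choiceMixin (C01 R).

Lemma C01_zero_continuous : {within `[0, 1], continuous (fun _ : R => 0 : R)}.
Proof. by move=> t; exact: cvg_cst. Qed.

HB.instance Definition _ := isPointed.Build (C01 R)
  (MkC01 C01_zero_continuous (fun _ _ => erefl)).

Definition supnorm (f : R -> R) : R := sup [set `|f t| | t in `[0, 1]].

Definition sup_open : set (set (C01 R)) :=
  [set U | forall x : C01 R, U x -> exists2 e : R, 0 < e &
     forall y : C01 R, supnorm (fun t => y t - x t) < e -> U y].

(* The Borel sigma-algebra of the sup-norm. *)
HB.instance Definition _ :=
  Measurable.copy (C01 R) (g_sigma_algebraType sup_open).

Lemma sq_continuous (x : C01 R) :
  {within `[0, 1], continuous (fun t => x t ^+ 2)}.
Proof.
by move=> t; have cx := @C01_continuous R x t; exact: (cvgM cx cx).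
Qed.

Lemma sq_out (x : C01 R) (t : R) : t \notin `[0, 1] -> x t ^+ 2 = 0.
Proof. by move=> /C01_out ->; rewrite expr0n. Qed.

Definition sq (x : C01 R) : C01p R :=
  @MkC01p R (MkC01 (@sq_continuous x) (@sq_out x))
    (fun t _ => sqr_ge0 (x t)).

End space.

(* The set of families [I -> S] with the product sigma-algebra. *)
Section product.
Context (I : Type) (d : measure_display) (S : measurableType d).

Definition cylinder : set (set (I -> S)) :=
  [set A | exists i (B : set S), measurable B /\ A = (fun x => x i) @^-1` B].

Definition paths := g_sigma_algebraType cylinder.

End product.

Section probability.
Context (R : realType) (d : measure_display) (T : measurableType d).
Context (d' : measure_display) (S : measurableType d').
Variable P : probability T R.
Local Open Scope ereal_scope.

Definition trajectory (X : int -> T -> S) : T -> paths int S :=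
  fun w k => X k w.

Definition mutually_independent (X : int -> T -> S) :=
  forall (s : seq int) (B : int -> set S), uniq s ->
    (forall k, measurable (B k)) ->
    P (\bigcap_(k in [set` s]) X k @^-1` B k) = \prod_(k <- s) P (X k @^-1` B k).

Definition identically_distributed (X : int -> T -> S) :=
  forall (k l : int) (B : set S), measurable B ->
    P (X k @^-1` B) = P (X l @^-1` B).

Definition iid (X : int -> T -> S) :=
  [/\ forall k, measurable_fun setT (X k),
      identically_distributed X & mutually_independent X].

Definition independent_copy (X X' : int -> T -> S) :=
  [/\ forall k, measurable_fun setT (X' k),
      forall A : set (paths int S), measurable A ->
        P (trajectory X' @^-1` A) = P (trajectory X @^-1` A) &
      forall A B : set (paths int S), measurable A -> measurable B ->
        P (trajectory X @^-1` A `&` trajectory X' @^-1` B) =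
        P (trajectory X @^-1` A) * P (trajectory X' @^-1` B)].

Definition strictly_stationary (X : int -> T -> S) :=
  forall (h : int) (A : set (paths int S)), measurable A ->
    P (trajectory (fun k => X (k + h)%R) @^-1` A) = P (trajectory X @^-1` A).

End probability.

(* [T', Q] is an enlargement of the probability space [T, P]: a random element
   [X] on [T] becomes [X \o p] on [T']. *)
Definition extension (R : realType) (d d' : measure_display)
    (T : measurableType d) (T' : measurableType d')
    (P : probability T R) (Q : probability T' R) (p : T' -> T) :=
  measurable_fun setT p /\ forall A, measurable A -> Q (p @^-1` A) = P A.

Section arch.
Context (R : realType).
Local Notation mu := (@lebesgue_measure R).

(* The integral is extended-real valued: the equation contains its finiteness,
   and the type of [beta] the continuity of [beta x]. *)
Definition kernel_operator (b : R -> R -> R) (beta : C01p R -> C01p R) :=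
  [/\ forall t s : R, t \in `[0, 1] -> s \in `[0, 1] -> 0 <= b t s,
      forall t : R, t \in `[0, 1] -> measurable_fun (`[0, 1] : set R) (b t) &
      forall (x : C01p R) (t : R), t \in `[0, 1] ->
        (\int[mu]_(s in `[0%R, 1%R]) (b t s * x s)%:E)%E = (beta x t)%:E].

Definition H (b : R -> R -> R) (x : C01p R) : R :=
  sup [set \int[mu]_(s in `[0, 1]) (b t s * x s) | t in `[0, 1]].

Context (d : measure_display) (T : measurableType d) (P : probability T R).

Definition arch_solution (eps : int -> T -> C01 R) (delta : C01p R)
    (beta : C01p R -> C01p R)
    (y : int -> T -> C01 R) (sigma2 : int -> T -> C01p R) :=
  [/\ forall k, measurable_fun setT (y k),
      forall k, measurable_fun setT (fun w => sigma2 k w : C01 R),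
      forall k, {ae P, forall w, forall t : R, t \in `[0, 1] ->
        y k w t = eps k w t * Num.sqrt (sigma2 k w t)} &
      forall k, {ae P, forall w, forall t : R, t \in `[0, 1] ->
        sigma2 k w t = delta t + beta (sq (y (k - 1) w)) t}].

Definition stationary_arch_solution (eps : int -> T -> C01 R) (delta : C01p R)
    (beta : C01p R -> C01p R)
    (y : int -> T -> C01 R) (sigma2 : int -> T -> C01p R) :=
  arch_solution eps delta beta y sigma2 /\
  strictly_stationary P (fun k w => (y k w, sigma2 k w : C01 R)).

End arch.

(* (e_{k-1}, e_{k-2}, ...) *)
Definition past (X : Type) (e : int -> X) (k : int) : nat -> X :=
  fun i => e (k - i.+1%:Z).

(* (e_{k-1}, ..., e_{k-m}, e'_{k-m-1}, e'_{k-m-2}, ...) *)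
Definition coupled_past (X : Type) (e e' : int -> X) (k : int) (m : nat) :
    nat -> X :=
  fun i => if (i < m)%N then past e k i else past e' k i.

(* Main.v *)
(** The conditional variance satisfies [sigma_k^2 = delta + beta (eps_{k-1}^2
    sigma_{k-1}^2)], a random affine recursion whose linear part has sup-norm
    Lipschitz constant at most [H (eps_{k-1}^2)].  Iterating from [delta] gives
    maps [S_n (e_0, e_1, ...)] with [|S_{n+1} - S_n| <= |delta| M_{n+1}], where
    [M_n = H (e_0^2) ... H (e_{n-1}^2)].  For [rho = E H^alpha < r < 1] put
    [Z = sum_n M_n^alpha / r^n]; by independence [E Z = 1 / (1 - rho / r)].
    Where [Z] is finite, [M_n <= Z^{1/alpha} r^{n/alpha}], so [S_n] converges to
    some [g] with [|g - S_m| <= C Z^{1/alpha} r^{m/alpha}].  As [S_m] depends on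
    [e_0, ..., e_{m-1}] only, two pasts [e], [e'] agreeing up to time [m] satisfy
    [|g e - g e'|^alpha <= C' r^m (Z e + Z e')], for every [alpha > 0] alike.
    Uniqueness: a stationary solution [s] obeys [|s_k - S_n| <= M_n |s_{k-n} -
    delta|], with [M_n -> 0] and [|s_{k-n} - delta|] of constant law, hence
    almost surely not divergent to infinity. *)

Require Import Defs.
From HB Require Import structures.
From mathcomp Require Import all_boot all_order all_algebra.
From mathcomp Require Import all_classical all_reals all_analysis.
From mathcomp Require Import measurable_realfun ring lra.
Import Order.TTheory GRing.Theory Num.Theory numFieldNormedType.Exports.
Local Open Scope classical_set_scope.
Local Open Scope ring_scope.

Set Implicit Arguments.
Unset Strict Implicit.
Unset Printing Implicit Defensive.

(** * Sup-norm on C[0,1] *)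

Section sup_norm.
Context {R : realType}.
Implicit Types (f : R -> R) (x y z : C01 R).

Lemma C01P x y : (forall t : R, t \in `[0, 1] -> x t = y t) -> x = y.
Proof.
case: x y => [f cf of_] [g cg og] /= fg.
have {}fg : f = g.
  apply/funext => t; have [/fg //|nt] := boolP (t \in `[(0 : R), 1]).
  by rewrite of_ // og.
by subst g; congr MkC01; exact: Prop_irrelevance.
Qed.

Lemma C01pP (x y : C01p R) :
  (forall t : R, t \in `[0, 1] -> x t = y t) -> x = y.
Proof.
case: x y => [x x0] [y y0] /= /C01P xy; subst y.
by congr MkC01p; exact: Prop_irrelevance.
Qed.

Lemma C01_epsdelta x (t e : R) : t \in `[0, 1] -> 0 < e ->
  exists2 d : R, 0 < d &
    forall u : R, u \in `[0, 1] -> `|u - t| < d -> `|x u - x t| < e.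
Proof.
move=> t01 e0; have /subspace_continuousP/(_ t t01) := @C01_continuous R x.
move=> /cvgrPdist_lt/(_ e e0) [d d0 dx]; exists d => // u u01 ut.
by rewrite distrC; apply: dx => //=; rewrite distrC.
Qed.

Lemma epsdelta_within f :
  (forall t e : R, t \in `[0, 1] -> 0 < e -> exists2 d : R, 0 < d &
    forall u : R, u \in `[0, 1] -> `|u - t| < d -> `|f u - f t| < e) ->
  {within `[0, 1], continuous f}.
Proof.
move=> fe; apply/subspace_continuousP => t t01; apply/cvgrPdist_lt => e e0.
have [d d0 dx] := fe t e t01 e0; exists d => //= u /= tu u01.
by rewrite distrC; apply: dx => //; rewrite distrC.
Qed.

(** Compactness of the interval, in near-covering form, makes local continuity uniform. The modulus
    is an inverse integer because it becomes a mesh in [near_step_cover]. *)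
Lemma C01_uniform x (e : R) : 0 < e -> exists n : nat, forall t u : R,
  t \in `[0, 1] -> u \in `[0, 1] -> `|t - u| < n.+1%:R^-1 -> `|x t - x u| < e.
Proof.
move=> e0; pose Q n (t : R) := t \in `[0, 1] -> forall u : R, u \in `[0, 1] ->
  `|t - u| < n.+1%:R^-1 -> `|x t - x u| < e.
suff Qt (t : R) : t \in `[0, 1] -> \forall t' \near t & n \near \oo, Q n t'.
  have /compact_near_coveringP/(_ nat \oo Q _ Qt) := @segment_compact R 0 1.
  by case=> n _ /(_ n (leqnn n)) nQ; exists n => t u t01; exact: (nQ t t01).
move=> t01.
have e20 : 0 < e / 2 by rewrite divr_gt0.
have [d d0 dx] := C01_epsdelta x t01 e20.
have d20 : 0 < d / 2 by rewrite divr_gt0.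
near=> t' n; rewrite /Q/= => t'01 u u01 tu.
have t't : `|t - t'| < d / 2.
  by near: t'; exact: cvgr_dist_lt.
have nd : n.+1%:R^-1 < d / 2 by near: n; exact: near_infty_natSinv_lt (PosNum d20).
have h1 : `|x t' - x t| < e / 2.
  by apply: dx => //; rewrite distrC; apply: lt_trans t't _; lra.
have h2 : `|x t - x u| < e / 2.
  rewrite distrC; apply: dx => //; apply: le_lt_trans (ler_distD t' _ _) _.
  by rewrite (splitr d) ltrD 1?distrC// (lt_trans _ nd)// distrC.
by apply: le_lt_trans (ler_distD (x t) _ _) _; rewrite (splitr e) ltrD.
Unshelve. all: by end_near.
Qed.

Lemma C01_bounded x : exists M : R, forall t : R, t \in `[0, 1] -> `|x t| <= M.
Proof.
have [M [_ Mx]] := compact_bounded (continuous_compact (@C01_continuous R x)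
  (@segment_compact R 0 1)).
exists (M + 1) => t t01; apply: (Mx (M + 1)); first by rewrite ltrDl.
by exists t.
Qed.

(** A [sup] of reals dominates its set only if that set is bounded above, whence [M]; compactness
    supplies it for elements of [C01 R]. *)
Lemma supnorm_ub f (M t : R) : (forall u : R, u \in `[0, 1] -> `|f u| <= M) ->
  t \in `[0, 1] -> `|f t| <= supnorm f.
Proof.
move=> fM t01; apply: ub_le_sup; last by exists t.
by exists M => _ [u u01 <-]; exact: fM.
Qed.

Lemma supnorm_le f (M : R) : (forall t : R, t \in `[0, 1] -> `|f t| <= M) ->
  supnorm f <= M.
Proof.
move=> fM; apply: ge_sup => [|_ [t t01 <-]]; last exact: fM.
by exists `|f 0|, 0 => //=; rewrite in_itv/= lexx ler01.
Qed.

Lemma eq_supnorm f g : (forall t : R, t \in `[0, 1] -> f t = g t) ->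
  supnorm f = supnorm g.
Proof.
move=> fg; congr sup; apply/seteqP; split => _ [t t01 <-].
  by exists t => //; rewrite fg.
by exists t => //; rewrite fg.
Qed.

Lemma C01_supnorm_ub x (t : R) : t \in `[0, 1] -> `|x t| <= supnorm x.
Proof. by have [M Mx] := C01_bounded x; exact: supnorm_ub Mx. Qed.

Lemma C01B_bounded x y :
  exists M : R, forall t : R, t \in `[0, 1] -> `|x t - y t| <= M.
Proof.
exists (supnorm x + supnorm y) => t t01.
by apply: le_trans (ler_normB _ _) _; rewrite lerD// C01_supnorm_ub.
Qed.

Lemma C01B_supnorm_ub x y (t : R) : t \in `[0, 1] ->
  `|x t - y t| <= supnorm (fun u => x u - y u).
Proof.
have [M Mxy] := C01B_bounded x y.
exact: (@supnorm_ub (fun u => x u - y u) M).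
Qed.

Lemma zero_in01 : (0 : R) \in `[0, 1].
Proof. by rewrite in_itv/= lexx ler01. Qed.

Lemma C01_supnorm_ge0 x : 0 <= supnorm x.
Proof. exact: le_trans (C01_supnorm_ub x zero_in01). Qed.

Lemma C01B_supnorm_ge0 x y : 0 <= supnorm (fun u => x u - y u).
Proof. exact: le_trans (C01B_supnorm_ub x y zero_in01). Qed.

Lemma supnormB_sym x y :
  supnorm (fun u => x u - y u) = supnorm (fun u => y u - x u).
Proof. by congr sup; apply/eq_imagel => t _; rewrite distrC. Qed.

Lemma supnormB_triangle x y z : supnorm (fun u => x u - z u) <=
  supnorm (fun u => x u - y u) + supnorm (fun u => y u - z u).
Proof.
apply: supnorm_le => t t01; apply: le_trans (ler_distD (y t) _ _) _.
by rewrite lerD// C01B_supnorm_ub.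
Qed.

Lemma supnormB_eq0 x y : supnorm (fun u => x u - y u) <= 0 -> x = y.
Proof.
move=> xy0; apply: C01P => t t01; apply/eqP; rewrite -subr_eq0 -normr_le0.
exact: le_trans (C01B_supnorm_ub x y t01) xy0.
Qed.

(** Density of the rationals and continuity reduce the sup-norm to countably many evaluations, the
    form in which measurability can be checked. *)
Lemma C01_rat_le x y (c : R) :
  (forall q : rat, ratr q \in `[(0 : R), 1] -> `|x (ratr q) - y (ratr q)| <= c) ->
  supnorm (fun u => x u - y u) <= c.
Proof.
move=> xc; apply: supnorm_le => t t01; apply/ler_addgt0Pr => e e0.
have e20 : 0 < e / 2 by rewrite divr_gt0.
have [d1 d10 d1x] := C01_epsdelta x t01 e20.
have [d2 d20 d2y] := C01_epsdelta y t01 e20.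
pose d := Num.min d1 d2; have d0 : 0 < d by rewrite lt_min d10.
(* Cutting []t - d, t + d[] down to []0, 1[] leaves a nonempty interval even when [t] is an end
   point. *)
have /rat_in_itvoo [q] : Num.max 0 (t - d) < Num.min 1 (t + d).
  move: t01; rewrite in_itv/= => /andP[t0 t1].
  by rewrite gt_max !lt_min ltr01/= !(ltr_pwDr, ltrBlDr, ltr_wpDl, ltrDl)//; lra.
rewrite in_itv/= gt_max lt_min => /andP[/andP[q0 qd] /andP[q1 dq]].
have q01 : (ratr q : R) \in `[(0 : R), 1] by rewrite in_itv/= !ltW.
have : `|ratr q - t| < d by rewrite ltr_distl qd.
rewrite lt_min => /andP[/(d1x _ q01) xq /(d2y _ q01) yq].
apply: le_trans (ler_distD (x (ratr q)) _ _) _.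
apply: le_trans (lerD (lexx _) (ler_distD (y (ratr q)) _ _)) _.
rewrite distrC (splitr e) addrCA lerD ?xc// lerD//; exact: ltW.
Qed.

End sup_norm.

(** * Borel sigma-algebra of C[0,1] *)

Section borel.
Context {R : realType}.

Lemma sup_open_measurable (U : set (C01 R)) : sup_open U -> measurable U.
Proof. exact: sub_sigma_algebra. Qed.

(** The preimage of each []a, +oo[] is open for the sup-norm, and these half-lines generate the
    Borel sets. *)
Lemma lipschitz_measurable (F : C01 R -> R) (K : R) :
  (forall x y, `|F x - F y| <= K * supnorm (fun t => x t - y t)) ->
  measurable_fun setT F.
Proof.
move=> FK _; apply: (measurability _ (RGenOInfty.measurableE R)) => //.
move=> /= _ [_ [a ->] <-]; apply: measurableI => //.
apply: sup_open_measurable => x /=; rewrite in_itv/= andbT => aFx.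
(* The sign of [K] is not assumed; [|K| + 1] gives a positive radius in all cases. *)
have K0 : 0 < `|K| + 1 by rewrite ltr_wpDl.
exists ((F x - a) / (`|K| + 1)) => [|y].
  by rewrite divr_gt0// subr_gt0.
rewrite ltr_pdivlMr// in_itv/= andbT => xy.
have := FK y x; have s0 := C01B_supnorm_ge0 y x.
have : K * supnorm (fun t => y t - x t) <= (`|K| + 1) * supnorm (fun t => y t - x t).
  by rewrite ler_wpM2r// (le_trans (ler_norm _))// lerDl.
rewrite mulrC in xy; move=> h1 h2.
have := le_lt_trans h2 (le_lt_trans h1 xy).
by rewrite ltr_distl => /andP[+ _]; rewrite opprB addrC subrK.
Qed.

(* For [i = (N, n, s)]: the step function with value [s`_j / (N + 1)] on
   [[j / (n + 1), (j + 1) / (n + 1)[]. *)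
Definition step_value (i : nat * nat * seq int) (t : R) : R :=
  (nth 0 i.2 (Num.truncn (t * i.1.2.+1%:R)))%:~R / i.1.1.+1%:R.

Definition near_step (i : nat * nat * seq int) : set (C01 R) :=
  [set x | forall q : rat, ratr q \in `[(0 : R), 1] ->
    `|x (ratr q) - step_value i (ratr q)| <= 2 / i.1.1.+1%:R].

Lemma near_step_diameter i x y : near_step i x -> near_step i y ->
  supnorm (fun t => x t - y t) <= 4 / i.1.1.+1%:R.
Proof.
move=> xi yi; apply: C01_rat_le => q q01.
apply: le_trans (ler_distD _ _ _) (le_trans (lerD (xi q q01) _) _).
  by rewrite distrC; exact: yi.
by rewrite -mulrDl ler_pM2r ?invr_gt0// -natrD.
Qed.

(** Sampling [x] on a mesh given by uniform continuity costs at most [1 / (N + 1)], and rounding the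
    samples down to multiples of [1 / (N + 1)] costs as much again. *)
Lemma near_step_cover (N : nat) (x : C01 R) : exists n s, near_step (N, n, s) x.
Proof.
have N0 : (0 : R) < N.+1%:R^-1 by rewrite invr_gt0.
have [n xn] := C01_uniform x N0.
(* The point [t = 1] has mesh index [n + 1], so [n + 2] samples are listed. *)
exists n, (mkseq (fun j => Num.floor (x (j%:R / n.+1%:R) * N.+1%:R)) n.+2).
move=> q q01; rewrite /step_value/=; set t : R := ratr q in q01 *.
have /andP[t0 t1] : 0 <= t <= 1 by move: q01; rewrite in_itv.
have tn0 : 0 <= t * n.+1%:R by rewrite mulr_ge0.
have := truncn_itv tn0; set j := Num.truncn _ => /andP[jt tj].
have jn : (j < n.+2)%N.
  rewrite -(ltr_nat R) (le_lt_trans jt)// (@le_lt_trans _ _ n.+1%:R) ?ltr_nat//.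
  by rewrite ler_piMl.
have n0 : (0 : R) < n.+1%:R by [].
have ut : j%:R / n.+1%:R <= t by rewrite ler_pdivrMr.
have tu : `|t - j%:R / n.+1%:R| < n.+1%:R^-1.
  rewrite ger0_norm ?subr_ge0// ltrBlDl -[X in _ + X]mul1r -mulrDl natr1.
  by rewrite ltr_pdivlMr.
have u01 : j%:R / n.+1%:R \in `[(0 : R), 1].
  by rewrite in_itv/= divr_ge0//= (le_trans ut).
rewrite nth_mkseq//; set u := (_ / _ : R) in ut tu u01 *.
have := xn t u q01 u01 tu; have /andP[] := floor_itv (x u * N.+1%:R).
set z := Num.floor _; rewrite intrD => zx xz xtu.
apply: le_trans (ler_distD (x u) _ _) _.
rewrite (_ : 2 = 1 + 1)// mulrDl mul1r lerD ?(ltW xtu)//.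
have -> : x u - z%:~R / N.+1%:R = (x u * N.+1%:R - z%:~R) / N.+1%:R.
  by rewrite mulrBl mulfK// gt_eqF.
rewrite normrM (gtr0_norm N0) ler_piMl// ?ltW// ger0_norm ?subr_ge0//.
by rewrite ltrBlDl.
Qed.

Context (d : measure_display) (T : measurableType d).

(* A sup-norm open set is a countable union of the sets [near_step i], each of
   which is determined by the values at rational points: this is where the
   separability of C[0,1] enters. *)
Lemma measurable_fun_C01 (f : T -> C01 R) :
  (forall t : R, t \in `[0, 1] -> measurable_fun setT (fun w => f w t)) ->
  measurable_fun setT f.
Proof.
move=> mf _; apply: (measurability (@sup_open R)) => // _ [U oU <-].
rewrite setTI.
have -> : f @^-1` U = \bigcup_(i : nat * nat * seq int)
    (if pselect (near_step i `<=` U) then f @^-1` near_step i else set0).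
  apply/seteqP; split => [w /= Ufw|w [i _]]; last first.
    by case: pselect => // iU; exact: iU.
  have [e e0 eU] := oU _ Ufw.
  (* [near_step_diameter] gives the diameter [4 / (N + 1)], which has to fall below [e]. *)
  have e40 : 0 < e / 4 by rewrite divr_gt0.
  have [N _ /(_ N (leqnn N)) Ne] := near_infty_natSinv_lt (PosNum e40).
  have [n [s ns]] := near_step_cover N (f w).
  exists (N, n, s) => //; case: pselect => //; apply => x xs; apply: eU.
  apply: le_lt_trans (near_step_diameter xs ns) _ => /=.
  by rewrite -ltr_pdivlMl// mulrC.
apply: countable_bigcupT_measurable => [|i]; first exact: countableP.
case: (pselect _) => [?|?] /=; last exact: measurable0.
have -> : f @^-1` near_step i = ~` (\bigcup_(q : rat)
    (if ratr q \in `[(0 : R), 1] then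
       ~` (f @^-1` [set x : C01 R |
         `|x (ratr q) - step_value i (ratr q)| <= 2 / i.1.1.+1%:R]) else set0)).
  rewrite setC_bigcup; apply/seteqP; split => [w fw q _ /=|w fw q q01].
    by case: ifPn => [q01 nfw|_ []]; apply: nfw; exact: fw.
  by have := fw q I; rewrite q01 setCK.
apply: measurableC; apply: countable_bigcupT_measurable => [|q].
  exact: countableP.
case: ifPn => // q01; apply: measurableC.
have : measurable_fun setT
    (fun w => `|f w (ratr q) - step_value i (ratr q)|).
  by apply: measurableT_comp => //; apply: measurable_funB => //; exact: mf.
move=> /(_ measurableT _ (measurable_itv `]-oo, 2 / i.1.1.+1%:R])); rewrite setTI.
by congr measurable; apply/seteqP; split => w /=; rewrite in_itv.
Qed.

End borel.

(** * Pointwise operations and the kernel operator *)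

Section operations.
Context {R : realType}.
Implicit Types x y : C01 R.

Lemma add_continuous x y : {within `[0, 1], continuous (fun t => x t + y t)}.
Proof.
move=> t; have cx := @C01_continuous R x t; have cy := @C01_continuous R y t.
exact: (cvgD cx cy).
Qed.

Lemma add_out x y (t : R) : t \notin `[0, 1] -> x t + y t = 0.
Proof. by move=> t01; rewrite !C01_out// addr0. Qed.

Definition C01_add x y : C01 R := MkC01 (@add_continuous x y) (@add_out x y).

Lemma sub_continuous x y : {within `[0, 1], continuous (fun t => x t - y t)}.
Proof.
move=> t; have cx := @C01_continuous R x t; have cy := @C01_continuous R y t.
exact: (cvgB cx cy).
Qed.

Lemma sub_out x y (t : R) : t \notin `[0, 1] -> x t - y t = 0.
Proof. by move=> t01; rewrite !C01_out// subr0. Qed.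

Definition C01_sub x y : C01 R := MkC01 (@sub_continuous x y) (@sub_out x y).

Lemma mul_continuous x y : {within `[0, 1], continuous (fun t => x t * y t)}.
Proof.
move=> t; have cx := @C01_continuous R x t; have cy := @C01_continuous R y t.
exact: (cvgM cx cy).
Qed.

Lemma mul_out x y (t : R) : t \notin `[0, 1] -> x t * y t = 0.
Proof. by move=> t01; rewrite C01_out// mul0r. Qed.

Definition C01_mul x y : C01 R := MkC01 (@mul_continuous x y) (@mul_out x y).

Lemma norm_continuous x : {within `[0, 1], continuous (fun t => `|x t|)}.
Proof. by move=> t; exact: (cvg_norm (@C01_continuous R x t)). Qed.

Lemma norm_out x (t : R) : t \notin `[0, 1] -> `|x t| = 0.
Proof. by move=> t01; rewrite C01_out// normr0. Qed.

Definition C01_norm x : C01p R :=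
  @MkC01p R (MkC01 (@norm_continuous x) (@norm_out x))
    (fun t _ => normr_ge0 (x t)).

Lemma sqrt_within_continuous x :
  {within `[0, 1], continuous (fun t => Num.sqrt (x t))}.
Proof.
move=> t; apply: (continuous_comp (@C01_continuous R x t)).
exact: sqrt_continuous.
Qed.

Lemma sqrt_out x (t : R) : t \notin `[0, 1] -> Num.sqrt (x t) = 0.
Proof. by move=> t01; rewrite C01_out// sqrtr0. Qed.

Definition C01_sqrt x : C01 R :=
  MkC01 (@sqrt_within_continuous x) (@sqrt_out x).

Definition C01p_mul (x y : C01p R) : C01p R :=
  @MkC01p R (C01_mul x y)
    (fun t t01 => mulr_ge0 (C01p_ge0 x t01) (C01p_ge0 y t01)).

Definition C01p_add (x y : C01p R) : C01p R :=
  @MkC01p R (C01_add x y)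
    (fun t t01 => addr_ge0 (C01p_ge0 x t01) (C01p_ge0 y t01)).

Lemma one_continuous : {within `[0, 1], continuous (fun t : R => (t \in `[0, 1])%:R : R)}.
Proof.
apply: epsdelta_within => t e t01 e0; exists 1 => // u u01 _.
by rewrite u01 t01 subrr normr0.
Qed.

Lemma one_out (t : R) : t \notin `[0, 1] -> (t \in `[(0 : R), 1])%:R = 0 :> R.
Proof. by move=> /negbTE ->. Qed.

Definition C01_one : C01p R := @MkC01p R (MkC01 one_continuous one_out)
  (fun t _ => ler0n R (t \in `[0, 1])).

End operations.

(** * Estimates for the kernel operator *)

Section kernel.
Context {R : realType} {b : R -> R -> R} {beta : C01p R -> C01p R}.
Hypothesis bbeta : kernel_operator b beta.
Local Notation mu := (@lebesgue_measure R).
Implicit Types (u v w : C01p R).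

Let b0 (t s : R) : t \in `[0, 1] -> s \in `[0, 1] -> 0 <= b t s.
Proof. by have [+ _ _] := bbeta; exact. Qed.

Let measurable_integrand (t : R) u : t \in `[0, 1] ->
  measurable_fun (`[0, 1] : set R) (fun s => (b t s * u s)%:E).
Proof.
move=> t01; apply/measurable_EFinP; apply: measurable_funM.
  by have [_ + _] := bbeta; exact.
by apply: subspace_continuous_measurable_fun => //; exact: C01_continuous.
Qed.

Let betaE u (t : R) : t \in `[0, 1] ->
  (\int[mu]_(s in `[0%R, 1%R]) (b t s * u s)%:E)%E = (beta u t)%:E.
Proof. by have [_ _ +] := bbeta; exact. Qed.

(** Integrals of non-negative functions are additive and monotone. The three-term form replaces a
    statement on [u - v], which need not lie in the domain of [beta]. *)
Lemma kernel_le u v w (c : R) : 0 <= c ->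
  (forall t : R, t \in `[0, 1] -> u t <= v t + c * w t) ->
  forall t : R, t \in `[0, 1] -> beta u t <= beta v t + c * beta w t.
Proof.
move=> c0 uvw t t01; rewrite -lee_fin EFinD EFinM -!betaE//.
have i0 x s : `[0, 1]%classic s -> (0 <= (b t s * (x : C01p R) s)%:E)%E.
  by move=> s01; rewrite lee_fin mulr_ge0 ?b0// C01p_ge0.
rewrite -ge0_integralZl_EFin//; [|exact: i0|exact: measurable_integrand].
rewrite -ge0_integralD//; [|exact: i0|exact: measurable_integrand| |]; last 2 first.
- by move=> s s01; rewrite mule_ge0 ?lee_fin// -lee_fin i0.
- by apply: measurable_funeM; exact: measurable_integrand.
apply: ge0_le_integral => //.
- exact: i0.
- exact: measurable_integrand.
- apply: emeasurable_funD; first exact: measurable_integrand.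
  by apply: measurable_funeM; exact: measurable_integrand.
- move=> s s01; rewrite -EFinM -EFinD lee_fin mulrCA -mulrDr.
  by rewrite ler_wpM2l ?b0// uvw.
Qed.

Lemma kernel_lipschitz u v w (c : R) : 0 <= c ->
  (forall t : R, t \in `[0, 1] -> `|u t - v t| <= c * w t) ->
  forall t : R, t \in `[0, 1] -> `|beta u t - beta v t| <= c * beta w t.
Proof.
move=> c0 uvw t t01; rewrite ler_distl lerBlDr.
have uvw' s : s \in `[(0 : R), 1] -> v s <= u s + c * w s /\ u s <= v s + c * w s.
  by move=> /uvw; rewrite ler_distl lerBlDr => /andP[].
by apply/andP; split; apply: kernel_le => // s /uvw'[].
Qed.

Lemma kernel_bound u w (c : R) : 0 <= c ->
  (forall t : R, t \in `[0, 1] -> u t <= c * w t) ->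
  forall t : R, t \in `[0, 1] -> beta u t <= c * beta w t.
Proof.
move=> c0 uw t t01; rewrite -lee_fin EFinM -!betaE//.
have i0 x s : `[0, 1]%classic s -> (0 <= (b t s * (x : C01p R) s)%:E)%E.
  by move=> s01; rewrite lee_fin mulr_ge0 ?b0// C01p_ge0.
rewrite -ge0_integralZl_EFin//; [|exact: i0|exact: measurable_integrand].
apply: ge0_le_integral => //.
- exact: i0.
- exact: measurable_integrand.
- by apply: measurable_funeM; exact: measurable_integrand.
- by move=> s s01; rewrite -EFinM lee_fin mulrCA ler_wpM2l ?b0// uw.
Qed.

(** [kernel_operator] identifies the integral with the real number [beta u t], so the real-valued
    integral in [H] is never a default value; as [beta u] is non-negative, the absolute value in
    [supnorm] changes nothing. *)
Lemma HE u : H b u = supnorm (beta u).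
Proof.
congr sup; apply/eq_imagel => t t01.
by rewrite /Rintegral betaE// ger0_norm// C01p_ge0.
Qed.

Lemma H_ge0 u : 0 <= H b u.
Proof. by rewrite HE C01_supnorm_ge0. Qed.

(** Pointwise, [w u] and [w v] differ by at most the constant [supnorm (u - v)] times [w], so
    [kernel_lipschitz] leaves [beta w], whose sup-norm is [H b w]. *)
Lemma kernel_mul_lipschitz u v w :
  supnorm (fun t => beta (C01p_mul w u) t - beta (C01p_mul w v) t) <=
  H b w * supnorm (fun t => u t - v t).
Proof.
apply: supnorm_le => t t01; have s0 := C01B_supnorm_ge0 u v.
have h := @kernel_lipschitz (C01p_mul w u) (C01p_mul w v) w _ s0.
apply: le_trans (h _ _ t01) _ => [s s01 /=|].
  rewrite -mulrBr normrM mulrC (ger0_norm (C01p_ge0 w s01)) ler_wpM2r ?C01p_ge0//.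
  exact: C01B_supnorm_ub.
rewrite mulrC ler_wpM2r// HE; apply: le_trans (ler_norm _) _.
exact: C01_supnorm_ub.
Qed.

(** Extends [beta] to signed functions: the sigma-algebra is put on [C01 R], so composing measurable
    maps calls for a map defined on all of it. *)
Definition kernel_norm (x : C01 R) : C01p R := beta (C01_norm x).

(** For fixed [t], evaluation of [kernel_norm] at [t] is Lipschitz, with the value at [t] of
    [beta C01_one] as constant. *)
Lemma measurable_kernel_norm :
  measurable_fun setT (fun x => kernel_norm x : C01 R).
Proof.
apply: measurable_fun_C01 => t t01.
apply: (@lipschitz_measurable _ _ (beta C01_one t)) => x y; rewrite mulrC.
have s0 := C01B_supnorm_ge0 x y.
apply: (@kernel_lipschitz _ _ _ _ s0) => // s s01 /=.
rewrite s01 mulr1; apply: le_trans (ler_dist_dist _ _) _.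
exact: C01B_supnorm_ub.
Qed.

Lemma kernel_normE u : kernel_norm u = beta u.
Proof.
by congr beta; apply: C01pP => t t01 /=; rewrite ger0_norm// C01p_ge0.
Qed.

End kernel.

(** * The iteration and its limit *)

Section geometric.
Context {R : realType}.

Lemma geometric_small (C q e : R) : 0 < q < 1 -> 0 < e ->
  exists n, C * q ^+ n < e.
Proof.
move=> /andP[q0 q1] e0.
have /cvgrPdist_lt/(_ e e0) [n _ /(_ n (leqnn n))] :=
  @cvg_geometric R C q ltac:(by rewrite gtr0_norm).
by rewrite /= sub0r normrN => h; exists n; apply: le_lt_trans (ler_norm _) h.
Qed.

Lemma le_geometric0 (a C q : R) : 0 < q < 1 ->
  (forall n, a <= C * q ^+ n) -> a <= 0.
Proof.
move=> q01 aC; rewrite leNgt; apply/negP => /(geometric_small C q01)[n].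
by rewrite ltNge aC.
Qed.

(* [x n t + C q^n / (1 - q)] is nonincreasing in [n] and
   [x n t - C q^n / (1 - q)] is nondecreasing: the limit lies between them. *)
Lemma C01_geometric_limit (x : nat -> C01 R) (C q : R) : 0 < q < 1 ->
  (forall n, supnorm (fun t => x n.+1 t - x n t) <= C * q ^+ n) ->
  exists y : C01 R,
    forall n, supnorm (fun t => x n t - y t) <= C * q ^+ n / (1 - q).
Proof.
move=> q01 xC; pose K n : R := C * q ^+ n / (1 - q).
have q1 : 0 < 1 - q by case/andP: q01 => _ q1; rewrite subr_gt0.
have KS n : K n - K n.+1 = C * q ^+ n.
  by rewrite /K -mulrBl exprS; field; rewrite gt_eqF.
have xK n (t : R) : t \in `[0, 1] -> `|x n.+1 t - x n t| <= K n - K n.+1.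
  by move=> t01; rewrite KS; apply: le_trans (xC n); exact: C01B_supnorm_ub.
have C0 : 0 <= C.
  by have := le_trans (C01B_supnorm_ge0 _ _) (xC 0%N); rewrite mulr1.
have K0 n : 0 <= K n.
  have /andP[q0 _] := q01.
  by rewrite divr_ge0 ?(ltW q1)// mulr_ge0// exprn_ge0// ltW.
have up (t : R) : t \in `[0, 1] ->
    {homo (fun n => x n t + K n) : n m / (n <= m)%N >-> m <= n}.
  move=> t01; apply: homo_leq => [|m n p h1 h2|n]; first exact: lexx.
    exact: le_trans h2 h1.
  by have := xK n t t01; rewrite ler_distl => /andP[_]; lra.
have low (t : R) : t \in `[0, 1] ->
    {homo (fun n => x n t - K n) : n m / (n <= m)%N >-> n <= m}.
  move=> t01; apply: homo_leq => [|m n p h1 h2|n]; first exact: lexx.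
    exact: le_trans h1 h2.
  by have := xK n t t01; rewrite ler_distl => /andP[+ _]; lra.
have lowup (t : R) n m : t \in `[0, 1] -> x n t - K n <= x m t + K m.
  move=> t01; apply: le_trans (low t t01 n (maxn n m) (leq_maxl _ _)) _.
  apply: le_trans (up t t01 m (maxn n m) (leq_maxr _ _)).
  by have := K0 (maxn n m); lra.
pose f (t : R) := if t \in `[0, 1] then inf (range (fun n => x n t + K n)) else 0.
have xf n (t : R) : t \in `[0, 1] -> `|x n t - f t| <= K n.
  move=> t01; rewrite /f t01; set l := inf _.
  have h1 : l <= x n t + K n.
    apply: ge_inf; last by exists n.
    by exists (x 0%N t - K 0%N) => _ [m _ <-]; exact: lowup.
  have h2 : x n t - K n <= l.
    apply: lb_le_inf; first by exists (x 0%N t + K 0%N), 0%N.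
    by move=> _ [m _ <-]; exact: lowup.
  by rewrite ler_distl; lra.
have cf : {within `[0, 1], continuous f}.
  apply: epsdelta_within => t e t01 e0.
  have e30 : 0 < e / 3 by rewrite divr_gt0.
  have [n Kn] := geometric_small (C / (1 - q)) q01 e30.
  have {}Kn : K n < e / 3 by rewrite /K mulrAC.
  have [d d0 dx] := C01_epsdelta (x n) t01 e30; exists d => // u u01 ut.
  have := xf n t t01; have := xf n u u01; have := dx u u01 ut.
  by rewrite ltr_distl !ler_distl ltr_distl; lra.
have of_ (t : R) : t \notin `[0, 1] -> f t = 0 by rewrite /f => /negbTE ->.
exists (MkC01 cf of_) => n; apply: supnorm_le => t t01; exact: xf.
Qed.

End geometric.

Section iteration.
Context {R : realType} {b : R -> R -> R} {beta : C01p R -> C01p R}.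
Hypothesis bbeta : kernel_operator b beta.
Variable delta : C01p R.
Implicit Types (e : nat -> C01 R) (u v : C01p R).

Definition seq_tail e : nat -> C01 R := fun i => e i.+1.

Definition arch_step (x : C01 R) u : C01p R :=
  C01p_add delta (beta (C01p_mul (sq x) u)).

(** [e 0] is the most recent innovation and acts last: a larger [n] starts further back in the past,
    and it is this backward iteration that converges along a fixed sequence. *)
Fixpoint arch_iter n e u : C01p R :=
  if n is n'.+1 then arch_step (e 0%N) (arch_iter n' (seq_tail e) u) else u.

Definition Hprod n e : R := \prod_(j < n) H b (sq (e j)).

Lemma Hprod_ge0 n e : 0 <= Hprod n e.
Proof. by apply: prodr_ge0 => j _; exact: H_ge0 bbeta _. Qed.

Lemma arch_step_lipschitz x u v :
  supnorm (fun t => arch_step x u t - arch_step x v t) <=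
  H b (sq x) * supnorm (fun t => u t - v t).
Proof.
apply: le_trans (kernel_mul_lipschitz bbeta u v (sq x)).
by rewrite (@eq_supnorm _ _ (fun t => beta (C01p_mul (sq x) u) t -
  beta (C01p_mul (sq x) v) t))// => t _ /=; lra.
Qed.

Lemma arch_iter_lipschitz n e u v :
  supnorm (fun t => arch_iter n e u t - arch_iter n e v t) <=
  Hprod n e * supnorm (fun t => u t - v t).
Proof.
elim: n e => [|n ih] e /=; first by rewrite /Hprod big_ord0 mul1r.
apply: le_trans (arch_step_lipschitz _ _ _) _.
by rewrite /Hprod big_ord_recl -mulrA ler_wpM2l ?(H_ge0 bbeta).
Qed.

(** Peeling off the oldest innovation instead of the newest exhibits consecutive iterates as one
    [n]-fold map with two starting points. *)
Lemma arch_iterSr n e u : arch_iter n.+1 e u = arch_iter n e (arch_step (e n) u).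
Proof. by elim: n e => [//|n ih] e; rewrite /= -ih. Qed.

Lemma eq_arch_iter n e e' u : (forall i, (i < n)%N -> e i = e' i) ->
  arch_iter n e u = arch_iter n e' u.
Proof.
elim: n e e' => [//|n ih] e e' ee' /=.
by rewrite ee'// (ih (seq_tail e) (seq_tail e'))// => i ni; exact: ee'.
Qed.

(** By [arch_iterSr] both iterates apply the same [n] steps, to [arch_step (e n) delta] and to
    [delta]; these differ by [beta (e_n^2 delta)], which is at most [H (e_n^2)] times the norm of
    [delta]. *)
Lemma arch_iter_step_le n e :
  supnorm (fun t => arch_iter n.+1 e delta t - arch_iter n e delta t) <=
  Hprod n.+1 e * supnorm delta.
Proof.
rewrite arch_iterSr; apply: le_trans (arch_iter_lipschitz _ _ _ _) _.
rewrite /Hprod big_ord_recr/= -mulrA ler_wpM2l ?Hprod_ge0//.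
apply: supnorm_le => t t01 /=.
rewrite (_ : delta t + _ - delta t = beta (C01p_mul (sq (e n)) delta) t); last first.
  by lra.
rewrite ger0_norm ?C01p_ge0//.
apply: le_trans (kernel_bound (w := sq (e n)) bbeta (C01_supnorm_ge0 delta) _ t01) _.
  move=> s s01 /=; rewrite mulrC ler_wpM2r ?sqr_ge0//.
  by apply: le_trans (ler_norm _) _; exact: C01_supnorm_ub.
rewrite mulrC ler_wpM2r ?C01_supnorm_ge0// (HE bbeta).
by apply: le_trans (ler_norm _) _; exact: C01_supnorm_ub.
Qed.

Variables alpha r : R.
Hypotheses (alpha0 : 0 < alpha) (r01 : 0 < r < 1).

Definition moment_term e n : R := Hprod n e `^ alpha / r ^+ n.

(** The variable [Z], extended-real valued because the series may diverge. *)
Definition moment_sum e : \bar R := (\sum_(n <oo) (moment_term e n)%:E)%E.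

Let q := r `^ alpha^-1.

(** The division by [1 - q] sums a geometric tail; the summand [1] keeps the constant positive when
    [delta] is zero. *)
Definition rate_const : R := (supnorm delta + 1) / (1 - q).

Lemma q_in01 : 0 < q < 1.
Proof.
have /andP[r0 r1] := r01; rewrite /q powR_gt0//=.
have <- : 1 `^ alpha^-1 = 1 :> R by rewrite powR1.
by rewrite gt0_ltr_powR ?invr_gt0 ?nnegrE// ltW.
Qed.

Lemma q_powR : q `^ alpha = r.
Proof.
have /andP[r0 r1] := r01.
by rewrite /q -powRrM mulVf ?gt_eqF// powRr1// ltW.
Qed.

Lemma moment_term_ge0 e n : 0 <= moment_term e n.
Proof.
by have /andP[r0 r1] := r01; rewrite divr_ge0 ?powR_ge0 ?exprn_ge0// ltW.
Qed.

Lemma moment_sum_ge0 e : (0 <= moment_sum e)%E.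
Proof. by apply: nneseries_ge0 => n _ _; rewrite lee_fin moment_term_ge0. Qed.

(** A term of a non-negative series is at most its sum, so [M_n^alpha <= Z r^n]; the power
    [1 / alpha] turns [r] into [q]. *)
Lemma Hprod_le e n : (moment_sum e < +oo)%E ->
  Hprod n e <= fine (moment_sum e) `^ alpha^-1 * q ^+ n.
Proof.
move=> Zoo; have /andP[r0 r1] := r01; have /andP[q0 q1] := q_in01.
have Zfin : moment_sum e \is a fin_num by rewrite ge0_fin_numE// moment_sum_ge0.
have Z0 : 0 <= fine (moment_sum e) by rewrite fine_ge0// moment_sum_ge0.
have : moment_term e n <= fine (moment_sum e).
  rewrite -lee_fin fineK//; apply: le_trans (nneseries_lim_ge n.+1 _) => /=.
    rewrite big_nat_recr//= leeDr// sume_ge0// => i _.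
    by rewrite lee_fin moment_term_ge0.
  by move=> i _ _; rewrite lee_fin moment_term_ge0.
rewrite ler_pdivrMr ?exprn_gt0// => h.
rewrite -[leLHS](@powRr1 _ (Hprod n e)) ?Hprod_ge0//.
rewrite -[X in _ `^ X](@mulfV _ alpha) ?gt_eqF// powRrM.
have -> : q ^+ n = (r ^+ n) `^ alpha^-1.
  by rewrite -!powR_mulrn ?(ltW q0) ?(ltW r0)// -!powRrM mulrC.
rewrite -powRM// ?exprn_ge0 ?(ltW r0)//.
by rewrite ge0_ler_powR ?invr_ge0 ?nnegrE ?powR_ge0 ?mulr_ge0 ?exprn_ge0
  ?(ltW r0) ?(ltW alpha0).
Qed.

(** Sequences with infinite moment sum get the default [delta], which keeps [g] total and
    measurable. The rate of convergence is part of the specification because the coupling bound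
    rests on it. *)
Definition arch_limit_at e u :=
  ((moment_sum e < +oo)%E -> forall n,
    supnorm (fun t => arch_iter n e delta t - u t) <=
    rate_const * fine (moment_sum e) `^ alpha^-1 * q ^+ n) /\
  (~ (moment_sum e < +oo)%E -> u = delta).

Definition arch_limit (g : (nat -> C01 R) -> C01p R) :=
  forall e, arch_limit_at e (g e).

Lemma arch_limit_exists : exists g, arch_limit g.
Proof.
suff /choice[g gP] : forall e, exists u, arch_limit_at e u by exists g.
move=> e.
have [Zoo|nZ] := pselect (moment_sum e < +oo)%E; last first.
  by exists delta; split.
have /andP[q0 q1] := q_in01.
set z := fine (moment_sum e) `^ alpha^-1.
have z0 : 0 <= z by rewrite powR_ge0.
have d0 := C01_supnorm_ge0 delta.
have [n|y xy] := @C01_geometric_limit R (fun n => arch_iter n e delta)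
    ((supnorm delta + 1) * z) q q_in01.
  apply: le_trans (arch_iter_step_le n e) _.
  rewrite mulrC -mulrA ler_pM ?Hprod_ge0 ?lerDl//.
  apply: le_trans (Hprod_le n.+1 Zoo) _.
  by rewrite ler_wpM2l// exprS ler_piMl ?exprn_ge0// ltW.
have {}xy n : supnorm (fun t => arch_iter n e delta t - y t) <=
    rate_const * z * q ^+ n.
  suff -> : rate_const * z * q ^+ n = (supnorm delta + 1) * z * q ^+ n / (1 - q).
    exact: xy.
  by rewrite /rate_const; ring.
(* The iterates are non-negative, so [- y t] is at most their distance to [y], which tends to 0. *)
have y0 (t : R) : t \in `[0, 1] -> 0 <= y t.
  move=> t01; rewrite -oppr_le0.
  apply: (@le_geometric0 _ _ (rate_const * z) q q_in01) => n.
  apply: le_trans (xy n); apply: le_trans (C01B_supnorm_ub _ _ t01).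
  apply: le_trans (ler_norm _).
  by have := C01p_ge0 (arch_iter n e delta) t01; lra.
by exists (MkC01p y0); split.
Qed.

Variable g : (nat -> C01 R) -> C01p R.
Hypothesis gP : arch_limit g.

(** Both sides are limits of the iterates [arch_iter n.+1 e delta]: the step with [e 0] is Lipschitz
    and so commutes with the limit along the tail. *)
Lemma arch_limit_rec e : (moment_sum e < +oo)%E ->
  (moment_sum (seq_tail e) < +oo)%E -> g e = arch_step (e 0%N) (g (seq_tail e)).
Proof.
move=> Ze Zs; have [/(_ Ze) ge _] := gP e; have [/(_ Zs) gs _] := gP (seq_tail e).
apply: C01pP => t t01; congr (C01_fun _ t); apply: supnormB_eq0.
set A := _ * _ in ge; set B := _ * _ in gs; have /andP[q0 q1] := q_in01.
have A0 : 0 <= A.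
  by have := le_trans (C01B_supnorm_ge0 _ _) (ge 0%N); rewrite mulr1.
apply: (@le_geometric0 _ _ (A + H b (sq (e 0%N)) * B) q q_in01) => n.
apply: le_trans (supnormB_triangle _ (arch_iter n.+1 e delta) _) _.
rewrite mulrDl lerD//.
  rewrite supnormB_sym; apply: le_trans (ge n.+1) _.
  by rewrite ler_wpM2l// exprS ler_piMl ?exprn_ge0// ltW.
apply: le_trans (arch_step_lipschitz _ _ _) _.
by rewrite -mulrA ler_wpM2l ?(H_ge0 bbeta).
Qed.

End iteration.

(** * Measurability *)

Section measurable_maps.
Context {R : realType} {d : measure_display} {T : measurableType d}.
Implicit Types f h : T -> C01 R.

Lemma measurable_eval f (t : R) : measurable_fun setT f ->
  measurable_fun setT (fun w => f w t).
Proof.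
move=> mf; have [t01|nt] := boolP (t \in `[(0 : R), 1]); last first.
  by under eq_fun do rewrite C01_out//; exact: measurable_cst.
apply: (@measurableT_comp _ _ _ _ _ _ (fun x : C01 R => x t)) => //.
apply: (@lipschitz_measurable _ _ 1) => x y; rewrite mul1r.
exact: C01B_supnorm_ub.
Qed.

Lemma measurable_add f h : measurable_fun setT f -> measurable_fun setT h ->
  measurable_fun setT (fun w => C01_add (f w) (h w)).
Proof.
move=> mf mh; apply: measurable_fun_C01 => t _ /=.
by apply: measurable_funD; exact: measurable_eval.
Qed.

Lemma measurable_mul f h : measurable_fun setT f -> measurable_fun setT h ->
  measurable_fun setT (fun w => C01_mul (f w) (h w)).
Proof.
move=> mf mh; apply: measurable_fun_C01 => t _ /=.
by apply: measurable_funM; exact: measurable_eval.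
Qed.

Lemma measurable_sq f : measurable_fun setT f ->
  measurable_fun setT (fun w => sq (f w) : C01 R).
Proof.
move=> mf; apply: measurable_fun_C01 => t _ /=.
by apply: measurable_funX; exact: measurable_eval.
Qed.

Lemma measurable_C01_sqrt f : measurable_fun setT f ->
  measurable_fun setT (fun w => C01_sqrt (f w)).
Proof.
move=> mf; apply: measurable_fun_C01 => t _ /=.
have ms : measurable_fun setT (@Num.sqrt R).
  by apply: continuous_measurable_fun; exact: sqrt_continuous.
by apply: (measurableT_comp ms); exact: measurable_eval.
Qed.

Lemma measurable_supnormB f h : measurable_fun setT f -> measurable_fun setT h ->
  measurable_fun setT (fun w => supnorm (fun t => f w t - h w t)).
Proof.
move=> mf mh.
have mB : measurable_fun setT (fun w => C01_sub (f w) (h w)).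
  apply: measurable_fun_C01 => t _ /=.
  by apply: measurable_funB; exact: measurable_eval.
apply: (@measurableT_comp _ _ _ _ _ _ (fun x : C01 R => supnorm x) _ _ _ mB).
apply: (@lipschitz_measurable _ _ 1) => x y; rewrite mul1r.
have h1 (u v : C01 R) : supnorm u <= supnorm v + supnorm (fun t => u t - v t).
  apply: supnorm_le => t t01.
  rewrite -[u t](subrK (v t)) addrC; apply: le_trans (ler_normD _ _) _.
  by rewrite lerD// ?C01_supnorm_ub// C01B_supnorm_ub.
by rewrite ler_distl lerBlDr h1 supnormB_sym h1.
Qed.

Lemma measurable_supnorm f : measurable_fun setT f ->
  measurable_fun setT (fun w => supnorm (f w)).
Proof.
move=> mf; have := measurable_supnormB mf (@measurable_cst _ _ _ _ _ (point : C01 R)).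
by under eq_fun do under eq_supnorm do rewrite subr0.
Qed.

Section arch.
Context {b : R -> R -> R} {beta : C01p R -> C01p R}.
Hypothesis bbeta : kernel_operator b beta.

Lemma measurable_H f : measurable_fun setT f ->
  measurable_fun setT (fun w => H b (sq (f w))).
Proof.
move=> mf; under eq_fun do rewrite (HE bbeta) -(kernel_normE (beta := beta)).
apply: measurable_supnorm.
apply: (measurableT_comp (measurable_kernel_norm bbeta)).
exact: measurable_sq.
Qed.

Variable delta : C01p R.

Lemma measurable_arch_step f (u : T -> C01p R) : measurable_fun setT f ->
  measurable_fun setT (fun w => u w : C01 R) ->
  measurable_fun setT (fun w => arch_step (beta := beta) delta (f w) (u w) : C01 R).
Proof.
move=> mf mu; apply: measurable_add; first exact: measurable_cst.
under eq_fun do rewrite -(kernel_normE (beta := beta)).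
apply: (measurableT_comp (measurable_kernel_norm bbeta)).
by apply: measurable_mul => //; exact: measurable_sq.
Qed.

Lemma measurable_arch_iter n (X : T -> nat -> C01 R) (u : T -> C01p R) :
  (forall i, measurable_fun setT (fun w => X w i)) ->
  measurable_fun setT (fun w => u w : C01 R) ->
  measurable_fun setT
    (fun w => arch_iter (beta := beta) delta n (X w) (u w) : C01 R).
Proof.
move=> + mu; elim: n X => [//|n ih] X mX /=.
apply: measurable_arch_step; first exact: mX.
by apply: (ih (fun w => seq_tail (X w))) => i; exact: mX.
Qed.

Variable X : T -> nat -> C01 R.
Hypothesis mX : forall i, measurable_fun setT (fun w => X w i).

Lemma measurable_Hprod n : measurable_fun setT (fun w => Hprod (b := b) n (X w)).
Proof. by apply: measurable_prod => i _; exact: measurable_H. Qed.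

Variables alpha r : R.
Hypotheses (alpha0 : 0 < alpha) (r01 : 0 < r < 1).

Lemma measurable_moment_term n :
  measurable_fun setT (fun w => moment_term (b := b) alpha r (X w) n).
Proof.
apply: measurable_funM => //.
by apply: (measurableT_comp (measurable_powR alpha)); exact: measurable_Hprod.
Qed.

Lemma measurable_moment_sum :
  measurable_fun setT (fun w => moment_sum (b := b) alpha r (X w)).
Proof.
apply: ge0_emeasurable_sum => n *; first by rewrite lee_fin moment_term_ge0.
by apply/measurable_EFinP; exact: measurable_moment_term.
Qed.

Lemma measurable_moment_sum_fin :
  measurable [set w | (moment_sum (b := b) alpha r (X w) < +oo)%E].
Proof.
rewrite -[X in measurable X]setTI.
exact: emeasurable_fun_infty_o measurableT measurable_moment_sum _.
Qed.

Variable g : (nat -> C01 R) -> C01p R.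
Hypothesis gP : arch_limit (b := b) (beta := beta) delta alpha r g.

(** [g] comes from a choice, but its specification makes each value a limit of iterates or [delta],
    according to a measurable event. *)
Lemma measurable_arch_limit : measurable_fun setT (fun w => g (X w) : C01 R).
Proof.
apply: measurable_fun_C01 => t t01.
pose h n w := if (moment_sum (b := b) alpha r (X w) < +oo)%E
  then arch_iter (beta := beta) delta n (X w) delta t else delta t.
apply: (@measurable_fun_cvg _ _ _ _ h) => [n|w _].
  apply: measurable_fun_ifT => //; last first.
    by apply: measurable_eval; exact: measurable_arch_iter.
  apply: (measurable_fun_bool true) => /=.
  by rewrite setTI; exact: measurable_moment_sum_fin.
have [h1 h2] := gP (X w); rewrite /h.
have [Zoo|nZ] := boolP (_ < +oo)%E; last first.
  by rewrite h2//; [exact: cvg_cst|exact/negP].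
have q01 := q_in01 alpha0 r01.
apply/cvgrPdist_lt => e e0; set A := rate_const delta alpha r *
  fine (moment_sum (b := b) alpha r (X w)) `^ alpha^-1.
have [N AN] := geometric_small A q01 e0.
near=> n; rewrite distrC.
apply: le_lt_trans (C01B_supnorm_ub _ _ t01) _.
apply: le_lt_trans (h1 Zoo n) _; apply: le_lt_trans AN.
have /andP[q0 q1] := q01.
have A0 : 0 <= A.
  by have := le_trans (C01B_supnorm_ge0 _ _) (h1 Zoo 0%N); rewrite mulr1.
rewrite ler_wpM2l// ler_wiXn2l ?(ltW q0) ?(ltW q1)//.
by near: n; exists N.
Unshelve. all: by end_near.
Qed.

End arch.
End measurable_maps.

(** * Expectation of a product of independent factors *)

Section product_expectation.
Context {R : realType} {d0 d1 d2 : measure_display}.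
Context {T0 : measurableType d0} {T1 : measurableType d1} {S : measurableType d2}.
Variables (P : probability T0 R) (Q : probability T1 R).
Local Open Scope ereal_scope.
Import HBNNSimple.

Let measurable_preimage (d3 d4 : measure_display) (A : measurableType d3)
    (A' : measurableType d4) (F : A -> A') B :
  measurable_fun setT F -> measurable B -> measurable (F @^-1` B).
Proof. by move=> mF mB; rewrite -[X in measurable X]setTI; exact: mF. Qed.

Let weight_nnsfun (W : T1 -> R) (X : T1 -> S) (Y : T0 -> S) (c : R)
    (f : {nnsfun S >-> R}) :
  (0 <= c)%R -> (forall x, 0 <= W x)%R -> measurable_fun setT W ->
  measurable_fun setT X -> measurable_fun setT Y ->
  (forall B, measurable B ->
    \int[Q]_x (W x * \1_B (X x))%:E = c%:E * P (Y @^-1` B)) ->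
  \int[Q]_x (W x * f (X x))%:E = c%:E * \int[P]_x (f (Y x))%:E.
Proof.
move=> c0 W0 mW mX mY WB.
have m1 k : measurable_fun setT (\1_(f @^-1` [set k]) : S -> R).
  exact: measurable_indic.
have mi k : measurable_fun setT (fun x => \1_(f @^-1` [set k]) (X x) : R).
  exact: (measurableT_comp (m1 k) mX).
have mi' k : measurable_fun setT (fun x => \1_(f @^-1` [set k]) (Y x) : R).
  exact: (measurableT_comp (m1 k) mY).
have fX x : (W x * f (X x))%:E =
    \sum_(k \in range f) (W x * (k * \1_(f @^-1` [set k]) (X x)))%:E.
  rewrite {1}fimfunE EFinM -fsumEFin// ge0_mule_fsumr//.
  by move=> k; exact: nnfun_muleindic_ge0.
have fY x : (f (Y x))%:E =
    \sum_(k \in range f) (k * \1_(f @^-1` [set k]) (Y x))%:E.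
  by rewrite {1}fimfunE -fsumEFin.
under eq_integral do rewrite fX.
under [in RHS]eq_integral do rewrite fY.
rewrite !ge0_integral_fsum//.
- rewrite ge0_mule_fsumr; last first.
    by move=> k; apply: integral_ge0 => x _; exact: nnfun_muleindic_ge0.
  apply: eq_fsbigr => k /set_mem [s _ fs].
  have k0 : (0 <= k)%R by rewrite -fs.
  under eq_integral do rewrite mulrCA EFinM.
  rewrite ge0_integralZl_EFin//; last 2 first.
  + by move=> x _; rewrite lee_fin mulr_ge0.
  + by apply/measurable_EFinP; exact: measurable_funM.
  rewrite WB//; under [in RHS]eq_integral do rewrite EFinM.
  rewrite ge0_integralZl_EFin//; last by apply/measurable_EFinP.
  under [in RHS]eq_integral do
    rewrite -[\1_(f @^-1` [set k]) _]/(\1_(Y @^-1` (f @^-1` [set k])) _).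
  rewrite integral_indic// ?setIT; last exact: measurable_preimage.
  by rewrite muleCA.
- by move=> k; apply/measurable_EFinP; exact: measurable_funM.
- by move=> k x _; exact: nnfun_muleindic_ge0.
- by move=> k; apply/measurable_EFinP; do 2 apply: measurable_funM => //.
- move=> k x _; rewrite EFinM mule_ge0 ?lee_fin//.
  by rewrite -lee_fin; exact: nnfun_muleindic_ge0.
Qed.

(** The last hypothesis says that the image under [X] of the measure with density [W] is [c] times
    the law of [Y]. Simple functions and monotone convergence carry this from indicators to [f]. *)
Lemma integral_weight (W : T1 -> R) (X : T1 -> S) (Y : T0 -> S) (c : R)
    (f : S -> R) :
  (0 <= c)%R -> (forall x, 0 <= W x)%R -> measurable_fun setT W ->
  measurable_fun setT X -> measurable_fun setT Y ->
  (forall s, 0 <= f s)%R -> measurable_fun setT f ->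
  (forall B, measurable B ->
    \int[Q]_x (W x * \1_B (X x))%:E = c%:E * P (Y @^-1` B)) ->
  \int[Q]_x (W x * f (X x))%:E = c%:E * \int[P]_x (f (Y x))%:E.
Proof.
move=> c0 W0 mW mX mY f0 mf WB.
have mEf : measurable_fun setT (EFin \o f) by exact/measurable_EFinP.
pose f_ := nnsfun_approx measurableT mEf.
have f_cvg s : (f_ n s)%:E @[n --> \oo] --> (f s)%:E.
  by apply: cvg_nnsfun_approx => // s' _ /=; rewrite lee_fin.
have f_nd s : {homo (fun n => f_ n s) : n m / (n <= m)%N >-> (n <= m)%R}.
  by move=> n m nm; exact/lefP/nd_nnsfun_approx.
transitivity (limn (fun n => \int[Q]_x (W x * f_ n (X x))%:E)).
  rewrite -monotone_convergence//.
  - apply: eq_integral => x _; apply/esym/cvg_lim => //.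
    under eq_fun do rewrite EFinM; rewrite EFinM.
    by apply: cvgeZl.
  - move=> n; apply/measurable_EFinP; apply: measurable_funM => //.
    exact: measurableT_comp.
  - by move=> n x _; rewrite lee_fin mulr_ge0.
  - by move=> x _ n m nm; rewrite lee_fin ler_wpM2l// f_nd.
transitivity (limn (fun n => c%:E * \int[P]_x (f_ n (Y x))%:E)).
  by congr (limn _); apply/funext => n; exact: weight_nnsfun.
apply/cvg_lim => //; apply: cvgeZl => //.
rewrite [X in _ --> X](_ : _ = \int[P]_x limn (fun n => (f_ n (Y x))%:E)).
  apply: cvg_monotone_convergence => //.
  - by move=> n; apply/measurable_EFinP; exact: measurableT_comp.
  - by move=> n x _; rewrite lee_fin.
  - by move=> x _ n m nm; rewrite lee_fin f_nd.
by apply: eq_integral => x _; apply/esym/cvg_lim.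
Qed.

Variables (X : nat -> T1 -> S) (Y : T0 -> S) (f : S -> R) (rho : R).
Hypotheses (mX : forall j, measurable_fun setT (X j)) (mY : measurable_fun setT Y).
Hypotheses (f0 : forall s, (0 <= f s)%R) (mf : measurable_fun setT f).
Hypothesis fY : \int[P]_x (f (Y x))%:E = rho%:E.

Let box n i (B : nat -> set S) :=
  [set x | forall j, (i <= j < n)%N -> B j (X j x)].

Hypothesis XY : forall n B, (forall j, measurable (B j)) ->
  Q [set x | forall j, (j < n)%N -> B j (X j x)] =
  \prod_(0 <= j < n) P (Y @^-1` B j).

Let measurable_box n i B : (forall j, measurable (B j)) -> measurable (box n i B).
Proof.
move=> mB; have -> : box n i B =
    \bigcap_(j in [set j | (i <= j < n)%N]) X j @^-1` B j by [].
by apply: bigcap_measurableType => j _; exact: measurable_preimage.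
Qed.

(* Replace the indicators of a product of independent events by [f], one factor
   at a time. *)
Let integral_prod_box n i B : (i <= n)%N -> (forall j, measurable (B j)) ->
  \int[Q]_x (\prod_(0 <= j < i) f (X j x) * \1_(box n i B) x)%:E =
  (rho ^+ i)%:E * \prod_(i <= j < n) P (Y @^-1` B j).
Proof.
elim: i B => [|i ih] B ni mB.
  under eq_integral do rewrite big_nil mul1r.
  rewrite integral_indic// ?setIT; last exact: measurable_box.
  by rewrite mul1e -XY.
have rho0 : (0 <= rho)%R.
  by rewrite -lee_fin -fY; apply: integral_ge0 => x _; rewrite lee_fin.
have Pfin : \prod_(i.+1 <= j < n) P (Y @^-1` B j) \is a fin_num.
  by apply: prode_fin_num => j _; apply: fin_num_measure; exact: measurable_preimage.
have P0 : 0 <= \prod_(i.+1 <= j < n) P (Y @^-1` B j) by exact: prode_ge0.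
(* [W] collects every factor except the [i]-th, to which [integral_weight] is applied. *)
pose W x := (\prod_(0 <= j < i) f (X j x) * \1_(box n i.+1 B) x)%R.
pose c := (rho ^+ i * fine (\prod_(i.+1 <= j < n) P (Y @^-1` B j)))%R.
under eq_integral do rewrite big_nat_recr//= mulrAC -/(W _).
rewrite (@integral_weight W (X i) Y c f)//.
- by rewrite fY /c EFinM fineK// muleAC -EFinM -exprSr.
- by rewrite mulr_ge0 ?exprn_ge0// fine_ge0.
- by move=> x; rewrite mulr_ge0// prodr_ge0.
- apply: measurable_funM; last by apply: measurable_indic; exact: measurable_box.
  apply: measurable_prod => j _.
  exact: (measurableT_comp mf).
(* The weight hypothesis for a test set [A] is the induction hypothesis with [B i] set to [A]. *)
- move=> A mA; pose B' j := if j == i then A else B j.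
  have mB' j : measurable (B' j) by rewrite /B'; case: ifP.
  rewrite /c EFinM fineK// -muleA [X in _ * X]muleC.
  have -> : P (Y @^-1` A) * \prod_(i.+1 <= j < n) P (Y @^-1` B j) =
      \prod_(i <= j < n) P (Y @^-1` B' j).
    rewrite [RHS]big_ltn// {1}/B' eqxx; congr (_ * _).
    by apply: eq_big_nat => j /andP[ij _]; rewrite /B' gtn_eqF.
  rewrite -(ih _ (ltnW ni) mB'); apply: eq_integral => x _; rewrite /W -mulrA.
  congr (_ * _)%:E; rewrite !indicE -natrM mulnb; congr ((_ : bool)%:R).
  apply/idP/idP => [/andP[]|].
    rewrite !inE => bx Ax j /andP[ij jn].
    rewrite /B'; case: eqVneq => [->//|ji]; apply: bx.
    by rewrite jn andbT ltn_neqAle eq_sym ji.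
  rewrite inE => bx; apply/andP; rewrite !inE; split=> [j /andP[ij jn]|].
    by have := bx j; rewrite /B' (gtn_eqF ij) jn (ltnW ij); exact.
  by have := bx i; rewrite /B' eqxx leqnn ni; exact.
Qed.

Lemma integral_prod_independent n :
  \int[Q]_x (\prod_(j < n) f (X j x))%:E = (rho ^+ n)%:E.
Proof.
have := @integral_prod_box n n (fun=> setT) (leqnn n) (fun=> measurableT).
rewrite big_geq// mule1 => <-; apply: eq_integral => x _.
by rewrite big_mkord indicE mem_set ?mulr1.
Qed.

End product_expectation.

(** * Laws of i.i.d. sequences *)

Section product_sigma_algebra.
Context {I : Type} {d d' : measure_display}.
Context {T : measurableType d} {S : measurableType d'}.

Lemma measurable_coordinate (i : I) :
  measurable_fun setT (fun x : paths I S => x i).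
Proof.
by move=> _ B mB; rewrite setTI; apply: sub_sigma_algebra; exists i, B.
Qed.

Lemma measurable_fun_paths (f : T -> paths I S) :
  (forall i, measurable_fun setT (fun w => f w i)) -> measurable_fun setT f.
Proof.
move=> mf; apply: (@measurability _ _ T (paths I S) setT f (@cylinder I d' S)) => //.
by move=> _ [_ [i [B [mB ->]]] <-]; exact: mf.
Qed.

End product_sigma_algebra.

Section iid_laws.
Context {R : realType} {d d' : measure_display}.
Context {T : measurableType d} {S : measurableType d'} (P : probability T R).
Local Open Scope ereal_scope.
Implicit Types X : int -> T -> S.

Lemma measurable_trajectory X : (forall k, measurable_fun setT (X k)) ->
  measurable_fun setT (trajectory X).
Proof. by move=> mX; apply: measurable_fun_paths => k; exact: mX. Qed.

Lemma iid_shift X (h : int) : iid P X -> iid P (fun k => X (k + h)%R).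
Proof.
move=> [mX idX indX]; split=> [k|k l B mB|s B us mB]; first exact: mX.
  exact: idX.
have := indX [seq (k + h)%R | k <- s] (fun j => B (j - h)%R).
rewrite map_inj_uniq; last exact: addIr.
move=> /(_ us (fun k => mB _)); rewrite big_map.
under eq_bigr do rewrite addrK.
move=> <-; congr (P _); apply/seteqP; split => [w Bw j /= /mapP[k ks ->]|w Bw k /= ks].
  by rewrite /= addrK; exact: Bw.
by have /= := Bw (k + h)%R; rewrite addrK; apply; apply/mapP; exists k.
Qed.

Definition box : set (set (paths int S)) :=
  [set A | exists s : seq int, exists B : int -> set S, [/\ uniq s,
    forall k, measurable (B k) & A = [set x | forall k, k \in s -> B k (x k)]]].

Lemma box_measurable A : box A -> measurable A.
Proof.
move=> [s [B [_ mB ->]]].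
have -> : [set x : paths int S | forall k, k \in s -> B k (x k)] =
    \bigcap_(k in [set` s]) (fun x : paths int S => x k) @^-1` B k by [].
apply: fin_bigcap_measurable => // k _.
by rewrite -[X in measurable X]setTI; exact: measurable_coordinate.
Qed.

Lemma measurable_boxE : @measurable _ (paths int S) = <<s box >>.
Proof.
apply/seteqP; split => A; apply: smallest_sub.
- exact: smallest_sigma_algebra.
- move=> _ [i [B [mB ->]]]; apply: sub_sigma_algebra.
  exists [:: i], (fun=> B); split => //.
  apply/seteqP; split => x /=; first by move=> Bx k; rewrite inE => /eqP ->.
  by apply; rewrite inE.
- exact: sigma_algebra_measurable.
- by move=> B; exact: box_measurable.
Qed.

Lemma setI_closed_box : setI_closed box.
Proof.
move=> _ _ [s1 [B1 [_ m1 ->]]] [s2 [B2 [_ m2 ->]]].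
pose C (s : seq int) (B : int -> set S) k := if k \in s then B k else setT.
exists (undup (s1 ++ s2)), (fun k => C s1 B1 k `&` C s2 B2 k); split.
- exact: undup_uniq.
- by move=> k; apply: measurableI; rewrite /C; case: ifP.
- apply/seteqP; split => x /=.
    move=> [x1 x2] k _; split; rewrite /C; case: ifPn => // ks.
      exact: x1.
    exact: x2.
  move=> xk; split => k ks; have := xk k; rewrite mem_undup mem_cat ks ?orbT/=.
    by move=> /(_ isT)[+ _]; rewrite /C ks.
  by move=> /(_ isT)[_]; rewrite /C ks.
Qed.

(** Independence makes the two laws agree on the boxes, a generating class closed under
    intersection; finite measures agreeing there are equal. *)
Lemma iid_law X X' : iid P X -> iid P X' ->
  (forall k B, measurable B -> P (X k @^-1` B) = P (X' k @^-1` B)) ->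
  forall A, measurable A ->
  P (trajectory X @^-1` A) = P (trajectory X' @^-1` A).
Proof.
move=> [mX _ indX] [mX' _ indX'] XX' A mA.
pose F : {mfun T >-> paths int S} := HB.pack (trajectory X)
  (isMeasurableFun.Build _ _ _ _ _ (measurable_trajectory mX)).
pose F' : {mfun T >-> paths int S} := HB.pack (trajectory X')
  (isMeasurableFun.Build _ _ _ _ _ (measurable_trajectory mX')).
apply: (@measure_unique _ _ _ box (fun=> setT) measurable_boxE setI_closed_box
  _ _ (pushforward P F) (pushforward P F') _ _ A mA).
- by move=> _; exists [::], (fun=> setT); split => //; apply/seteqP; split.
- by rewrite bigcup_const.
- move=> _ [s [B [us mB ->]]] /=; rewrite /pushforward.
  have e (Z : int -> T -> S) : trajectory Z @^-1`
      [set x | forall k, k \in s -> B k (x k)] =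
      \bigcap_(k in [set` s]) Z k @^-1` B k by [].
  by rewrite !e indX// indX'//; apply: eq_bigr => k _; exact: XX'.
- move=> _; apply: le_lt_trans (ltry 1); apply: probability_le1.
  by rewrite -[X in measurable X]setTI; exact: (measurable_trajectory mX).
Qed.

Lemma iid_shift_law X (h : int) A : iid P X -> measurable A ->
  P (trajectory (fun k => X (k + h)%R) @^-1` A) = P (trajectory X @^-1` A).
Proof.
move=> iX mA; apply: iid_law => //; first exact: iid_shift.
by move=> k B mB; have [_ + _] := iX; exact.
Qed.

(** Independence at the distinct times [k - (j + 1)]. The mask [J] lets the segments before and
    after the coupling index be treated separately. *)
Lemma iid_past X (k l : int) (n : nat) (J : pred nat) (B : nat -> set S) :
  iid P X -> (forall j, measurable (B j)) ->
  P [set w | forall j, (j < n)%N -> J j -> B j (past (X ^~ w) k j)] =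
  \prod_(0 <= j < n | J j) P (X l @^-1` B j).
Proof.
(* [idx] inverts [j] to [k - (j + 1)]; the predecessor undoes the offset by one. *)
move=> [mX idX indX] mB; pose idx (i : int) := (`|k - i|%N).-1.
have idxK j : idx (k - j.+1%:Z)%R = j by rewrite /idx opprB addrC subrK.
have := indX [seq (k - j.+1%:Z)%R | j <- iota 0 n & J j] (B \o idx).
rewrite map_inj_uniq ?filter_uniq ?iota_uniq//; last first.
  by move=> i j ij; rewrite -[i]idxK ij idxK.
move=> /(_ isT (fun=> mB _)); rewrite big_map big_filter /=.
rewrite /index_iota subn0; under [X in _ = X -> _]eq_bigr do
  rewrite /= idxK (idX _ l)//.
move=> <-; congr (P _); apply/seteqP; split => [w Bw i /= /mapP[j]|w Bw j jn Jj].
  by rewrite mem_filter mem_iota => /andP[Jj jn] ->; rewrite /= idxK; exact: Bw.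
have /= := Bw (k - j.+1%:Z)%R; rewrite idxK; apply; apply/mapP; exists j => //.
by rewrite mem_filter Jj mem_iota.
Qed.

End iid_laws.

(** * Almost sure finiteness and non-divergence *)

Section negligible.
Context {R : realType} {d : measure_display} {T : measurableType d}.
Variable P : probability T R.
Local Open Scope ereal_scope.

(** All [W n] have the same tails, so the event that [K < W n] for all large [n] is no more probable
    than [K < W 0], whose probability tends to 0 as [K] grows. *)
Lemma diverging_negligible (W : nat -> T -> R) :
  (forall n, measurable_fun setT (W n)) ->
  (forall n a, P [set w | a < W n w]%R = P [set w | a < W 0%N w]%R) ->
  P.-negligible [set w | forall K : nat, exists N, forall n, (N <= n)%N ->
    (K%:R < W n w)%R].
Proof.
move=> mW WW.
have mA n (a : R) : measurable [set w | a < W n w]%R.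
  have := mW n measurableT _ (measurable_itv `]a, +oo[); rewrite setTI.
  by congr measurable; apply/seteqP; split => w /=; rewrite in_itv/= andbT.
pose V K N := \bigcap_(n in [set n | (N <= n)%N]) [set w | K%:R < W n w]%R.
have mV K N : measurable (V K N) by apply: bigcap_measurableType.
pose U K := \bigcup_N V K N.
have mU K : measurable (U K) by exact: bigcup_measurable.
have UK K : P (U K) <= P [set w | K%:R < W 0%N w]%R.
  have cV : P (V K N) @[N --> \oo] --> P (U K).
    apply: nondecreasing_cvg_mu => //; first exact: mU.
    move=> N M NM; apply/subsetPset => w Vw n /= Mn; apply: Vw => /=.
    exact: leq_trans NM Mn.
  rewrite -(cvg_lim _ cV)//; apply: lime_le; first by apply/cvg_ex; exists (P (U K)).
  apply: nearW => N; rewrite -(WW N); apply: le_measure; rewrite ?inE//.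
  by move=> w; apply => /=.
exists (\bigcap_K U K); split.
- exact: bigcapT_measurable.
- have c0 : P [set w | K%:R < W 0%N w]%R @[K --> \oo] --> 0.
    have -> : 0 = P (\bigcap_K [set w | K%:R < W 0%N w]%R).
      rewrite [X in P X](_ : _ = set0) ?measure0//; apply/seteqP; split => // w Ww.
      have := Ww (Num.truncn (W 0%N w)).+1 I; apply/negP; rewrite -leNgt.
      exact/ltW/truncnS_gt.
    apply: nonincreasing_cvg_mu => //.
    + by apply: le_lt_trans (ltry 1); exact: probability_le1.
    + exact: bigcapT_measurable.
    + move=> K M KM; apply/subsetPset => w /=; apply: le_lt_trans.
      by rewrite ler_nat.
  apply/eqP; rewrite eq_le measure_ge0 andbT -(cvg_lim _ c0)//.
  apply: lime_ge; first by apply/cvg_ex; exists 0.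
  apply: nearW => K; apply: le_trans (UK K); apply: le_measure; rewrite ?inE//.
    exact: bigcapT_measurable.
  by move=> w; exact.
- by move=> w Ww K _; have [N NW] := Ww K; exists N.
Qed.

Lemma ae_lty (f : T -> \bar R) : measurable_fun setT f -> (forall x, 0 <= f x) ->
  \int[P]_x f x < +oo -> {ae P, forall x, f x < +oo}.
Proof.
move=> mf f0 foo; have fi : P.-integrable setT f.
  apply/integrableP; split => //; under eq_integral do rewrite gee0_abs//.
  exact: foo.
apply: filterS (integrable_ae measurableT fi) => x /(_ I).
by rewrite ge0_fin_numE.
Qed.

End negligible.

(** * Expectation of the moment sum *)

Section moments.
Context {R : realType} {b : R -> R -> R} {beta : C01p R -> C01p R}.
Hypothesis bbeta : kernel_operator b beta.
Context {d0 d1 : measure_display} {T0 : measurableType d0} {T1 : measurableType d1}.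
Variables (P : probability T0 R) (Q : probability T1 R).
Variables (alpha r rho : R) (Y : T0 -> C01 R) (X : nat -> T1 -> C01 R).
Hypotheses (r01 : 0 < r < 1) (rhor : rho < r).
Hypotheses (mX : forall j, measurable_fun setT (X j)) (mY : measurable_fun setT Y).
Local Open Scope ereal_scope.
Hypothesis YH : \int[P]_x (H b (sq (Y x)) `^ alpha)%:E = rho%:E.
Hypothesis XY : forall n B, (forall j, measurable (B j)) ->
  Q [set x | forall j, (j < n)%N -> B j (X j x)] =
  \prod_(0 <= j < n) P (Y @^-1` B j).

Let powR_prod n (F : nat -> R) : (forall j, 0 <= F j)%R ->
  ((\prod_(j < n) F j) `^ alpha = \prod_(j < n) F j `^ alpha)%R.
Proof.
move=> F0; elim: n => [|n ih]; first by rewrite !big_ord0 powR1.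
by rewrite !big_ord_recr/= powRM// ?ih// prodr_ge0.
Qed.

(** By independence [Hprod n] has [alpha]-moment [rho^n], which leaves a geometric series of ratio
    [rho / r < 1]. The sequence lives on [Q] and its marginal law is read on [P], so that the bound
    covers both a past and a coupled past. *)
Lemma expectation_moment_sum :
  \int[Q]_w moment_sum (b := b) alpha r (fun j => X j w) <=
  ((1 - rho / r)^-1)%:E.
Proof.
have /andP[r0 r1] := r01.
have rho0 : (0 <= rho)%R.
  by rewrite -lee_fin -YH; apply: integral_ge0 => x _; rewrite lee_fin powR_ge0.
have t0 n w : 0 <= (moment_term (b := b) alpha r (fun j => X j w) n)%:E.
  by rewrite lee_fin moment_term_ge0.
rewrite integral_nneseries//; last first.
  by move=> n; apply/measurable_EFinP; exact: (measurable_moment_term bbeta).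
have mH : measurable_fun setT (fun x : C01 R => H b (sq x) `^ alpha)%R.
  apply: (measurableT_comp (measurable_powR alpha)).
  by apply: (measurable_H bbeta); exact: measurable_id.
have term n : \int[Q]_w (moment_term (b := b) alpha r (fun j => X j w) n)%:E =
    ((rho / r) ^+ n)%:E.
  rewrite expr_div_n EFinM.
  rewrite -(@integral_prod_independent _ _ _ _ _ _ _ P Q X Y
    (fun x => H b (sq x) `^ alpha)%R rho mX mY _ mH YH XY n); last first.
    by move=> s; exact: powR_ge0.
  rewrite muleC -ge0_integralZl_EFin//.
  - apply: eq_integral => w _; rewrite -EFinM mulrC; congr (_ / _)%:E.
    rewrite /Hprod (powR_prod _ (F := fun j => H b (sq (X j w))))// => j.
    exact: (H_ge0 bbeta).
  - by move=> w _; rewrite lee_fin prodr_ge0// => j _; exact: powR_ge0.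
  - apply/measurable_EFinP; apply: measurable_prod => j _.
    exact: (measurableT_comp mH).
  - by rewrite invr_ge0 exprn_ge0// ltW.
under eq_eseriesr do rewrite term.
have x0 : (0 <= rho / r)%R by rewrite divr_ge0// ltW.
have x1 : (rho / r < 1)%R by rewrite ltr_pdivrMr// mul1r.
apply: lime_le; first by apply: is_cvg_nneseries => n _ _; rewrite lee_fin exprn_ge0.
apply: nearW => n; rewrite sumEFin lee_fin.
have := @geometric_seriesE R 1 (rho / r)%R (negbT (lt_eqF x1)) => /(congr1 (@^~ n)).
rewrite /series /geometric /=; under eq_bigr do rewrite mul1r.
move=> ->; rewrite mul1r ler_piMl ?invr_ge0 ?subr_ge0 ?(ltW x1)//.
by rewrite lerBlDr lerDl exprn_ge0.
Qed.

End moments.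

(** * The stationary solution *)

Lemma le_mul_add_fin (R : realType) (a K : R) (x y : \bar R) : 0 < K ->
  (0 <= x)%E -> (0 <= y)%E ->
  ((x < +oo)%E -> (y < +oo)%E -> (a%:E <= K%:E * (x + y))%E) ->
  (a%:E <= K%:E * (x + y))%E.
Proof.
move=> K0; case: x => [x| |]; case: y => [y| |] //= _ _ h.
- by apply: h; rewrite ltry.
- by rewrite gt0_muley ?leey ?lte_fin.
- by rewrite gt0_muley ?leey ?lte_fin.
- by rewrite gt0_muley ?leey ?lte_fin.
Qed.

Lemma integral_le_mul_add (R : realType) (d : measure_display)
    (T : measurableType d) (Q : probability T R) (K a : R) (f : T -> R)
    (F F' : T -> \bar R) : 0 <= K ->
  measurable_fun setT f -> (forall w, 0 <= f w) ->
  measurable_fun setT F -> measurable_fun setT F' ->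
  (forall w, 0 <= F w)%E -> (forall w, 0 <= F' w)%E ->
  (forall w, (f w)%:E <= K%:E * (F w + F' w))%E ->
  (\int[Q]_w F w <= a%:E)%E -> (\int[Q]_w F' w <= a%:E)%E ->
  (\int[Q]_w (f w)%:E <= (K * a * 2)%:E)%E.
Proof.
move=> K0 mf f0 mF mF' F0 F0' fF Fa Fa'.
apply: (@le_trans _ _ (\int[Q]_w (K%:E * (F w + F' w)))%E).
  apply: ge0_le_integral => //.
  - by move=> w _; rewrite lee_fin.
  - exact/measurable_EFinP.
  - by apply: measurable_funeM; exact: emeasurable_funD.
rewrite ge0_integralZl_EFin//; last 2 first.
- by move=> w _; rewrite adde_ge0.
- exact: emeasurable_funD.
rewrite ge0_integralD// -mulrA EFinM lee_wpmul2l ?lee_fin//.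
by rewrite mulr_natr mulr2n EFinD leeD.
Qed.

Section arch_process.
Context {R : realType} {d : measure_display} {T : measurableType d}.
Variables (P : probability T R) (eps : int -> T -> C01 R) (delta : C01p R).
Variables (b : R -> R -> R) (beta : C01p R -> C01p R) (alpha r rho : R).
Hypotheses (eps_iid : iid P eps) (bbeta : kernel_operator b beta).
Hypotheses (alpha0 : 0 < alpha) (r01 : 0 < r < 1) (rhor : rho < r).
Hypothesis epsH : (\int[P]_w (H b (sq (eps 1 w)) `^ alpha)%:E = rho%:E)%E.
Variable g : (nat -> C01 R) -> C01p R.
Hypothesis gP : arch_limit (b := b) (beta := beta) delta alpha r g.

Let meps k : measurable_fun setT (eps k).
Proof. by have [+ _ _] := eps_iid; exact. Qed.

Definition sigma2_of (x : int -> C01 R) (k : int) : C01p R := g (past x k).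

Definition y_of (x : int -> C01 R) (k : int) : C01 R :=
  C01_mul (x k) (C01_sqrt (sigma2_of x k)).

Lemma sq_mul_sqrt (x : C01 R) (u : C01p R) :
  sq (C01_mul x (C01_sqrt u)) = C01p_mul (sq x) u.
Proof.
by apply: C01pP => t t01 /=; rewrite exprMn sqr_sqrtr// C01p_ge0.
Qed.

Lemma ae_moment_sum_fin k :
  {ae P, forall w, (moment_sum (b := b) alpha r (past (eps ^~ w) k) < +oo)%E}.
Proof.
apply: ae_lty => [|w|].
- by apply: (measurable_moment_sum bbeta) => // i; exact: meps.
- exact: moment_sum_ge0.
- apply: le_lt_trans (ltry (1 - rho / r)^-1).
  apply: (expectation_moment_sum bbeta r01 rhor
    (X := fun j => eps (k - j.+1%:Z)) (fun=> meps _) (meps 1) epsH) => n B mB.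
  rewrite -(@iid_past _ _ _ _ _ P eps k 1 n predT B eps_iid mB); congr (P _).
  by apply/seteqP; split => w Bw j jn; [move=> _; exact: Bw|exact: Bw].
Qed.

Lemma past_tail (x : int -> C01 R) k : seq_tail (past x k) = past x (k - 1).
Proof.
apply/funext => i; rewrite /seq_tail /past; congr (x _).
by rewrite -addrA -opprD -intS.
Qed.

(** Almost surely the pasts at [k] and at [k - 1] both have finite moment sum, and there
    [arch_limit_rec] gives the recursion. *)
Lemma arch_solution_of : arch_solution P eps delta beta
  (fun k w => y_of (eps ^~ w) k) (fun k w => sigma2_of (eps ^~ w) k).
Proof.
have ms k : measurable_fun setT (fun w => sigma2_of (eps ^~ w) k : C01 R).
  by apply: (measurable_arch_limit bbeta _ alpha0 r01 gP) => i; exact: meps.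
split=> [k|k|k|k].
- apply: measurable_mul; first exact: meps.
  by apply: measurable_C01_sqrt; exact: ms.
- exact: ms.
- by apply: aeW => w t t01.
- apply: filterS2 (ae_moment_sum_fin k) (ae_moment_sum_fin (k - 1)) => w Zk Zk1 t _.
  rewrite /sigma2_of (arch_limit_rec bbeta alpha0 r01 gP Zk) ?past_tail//=.
  by rewrite /y_of sq_mul_sqrt.
Qed.

(** The solution is the image of the innovations under a measurable map commuting with time shifts,
    and the law of an i.i.d. sequence is shift invariant. *)
Lemma stationary_arch_solution_of : stationary_arch_solution P eps delta beta
  (fun k w => y_of (eps ^~ w) k) (fun k w => sigma2_of (eps ^~ w) k).
Proof.
split; first exact: arch_solution_of.
move=> h A mA.
pose Phi (x : paths int (C01 R)) : paths int (C01 R * C01 R)%type :=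
  fun k => (y_of x k, sigma2_of x k : C01 R).
have mc k : measurable_fun setT (fun x : paths int (C01 R) => x k).
  exact: measurable_coordinate.
have msg k : measurable_fun setT
    (fun x : paths int (C01 R) => sigma2_of x k : C01 R).
  by apply: (measurable_arch_limit bbeta _ alpha0 r01 gP) => i; exact: mc.
have mPhi : measurable_fun setT Phi.
  apply: measurable_fun_paths => k; apply: measurable_fun_pair; last exact: msg.
  apply: measurable_mul; first exact: mc.
  by apply: measurable_C01_sqrt; exact: msg.
have mA' : measurable (Phi @^-1` A) by rewrite -[X in measurable X]setTI; exact: mPhi.
pose Z k w := (y_of (eps ^~ w) k, sigma2_of (eps ^~ w) k : C01 R).
have Zh : trajectory (fun k => Z (k + h)) =
    Phi \o trajectory (fun k => eps (k + h)).
  apply/funext => w; apply/funext => k.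
  have pE : past (fun j => eps (j + h) w) k = past (eps ^~ w) (k + h).
    by apply/funext => i; rewrite /past addrAC.
  by rewrite /trajectory /Phi/= /Z /y_of /sigma2_of pE.
have Z0 : trajectory Z = Phi \o trajectory eps by [].
rewrite -/Z Zh Z0 !comp_preimage.
exact: iid_shift_law.
Qed.

Lemma stationary_arch_solution_unique y' sigma2' :
  stationary_arch_solution P eps delta beta y' sigma2' ->
  forall k, {ae P, forall w, y' k w = y_of (eps ^~ w) k /\
                             sigma2' k w = sigma2_of (eps ^~ w) k}.
Proof.
move=> [[my' ms' ey es] stat] k.
have step j : {ae P, forall w,
    sigma2' j w = arch_step (beta := beta) delta (eps (j - 1) w) (sigma2' (j - 1) w)}.
  apply: filterS2 (ey (j - 1)) (es j) => w yw sw; apply: C01pP => t t01.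
  rewrite sw//= -sq_mul_sqrt; congr (_ + beta (sq _) t).
  by apply: C01P => s s01 /=; exact: yw.
(* Countably many times are treated at once, so that the recursion can be iterated along one
   path. *)
have {}step : {ae P, forall w, forall n : nat, sigma2' (k - n%:Z) w =
    arch_step (beta := beta) delta (past (eps ^~ w) k n) (sigma2' (k - n.+1%:Z) w)}.
  apply: ae_foralln => n; apply: filterS (step (k - n%:Z)) => w.
  by rewrite -addrA -opprD -PoszD addn1.
pose W n w := supnorm (fun t => sigma2' (k - n%:Z) w t - delta t).
have mW n : measurable_fun setT (W n).
  by apply: measurable_supnormB; [exact: ms'|exact: measurable_cst].
(* Stationarity of the given solution, for an event on the coordinate [k] and the shift by [-n]. *)
have WW n a : P [set w | a < W n w] = P [set w | a < W 0%N w].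
  pose A := [set x : paths int (C01 R * C01 R)%type |
    a < supnorm (fun t => (x k).2 t - delta t)].
  have mA : measurable A.
    have m2 : measurable_fun setT
        (fun x : paths int (C01 R * C01 R)%type => (x k).2).
      have mk := @measurable_coordinate int _ (C01 R * C01 R)%type k.
      exact: (measurableT_comp measurable_snd mk).
    have := measurable_supnormB m2 (measurable_cst (delta : C01 R)).
    move=> /(_ measurableT _ (measurable_itv `]a, +oo[)); rewrite setTI.
    by congr measurable; apply/seteqP; split => x /=; rewrite in_itv/= andbT.
  have := stat (- n%:Z) A mA; rewrite /W subr0 => <-.
  by [].
have div := diverging_negligible mW WW.
have ae_s : {ae P, forall w, sigma2' k w = sigma2_of (eps ^~ w) k}.
  have : {ae P, forall w, ~ forall K : nat, exists N, forall n, (N <= n)%N ->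
      K%:R < W n w}.
    by apply: negligibleS div => w /= /contrapT.
  move=> nW.
  apply: filterS3 nW step (ae_moment_sum_fin k) => w nWw sw Zw.
  apply: C01pP => t t01; congr (C01_fun _ t); apply: supnormB_eq0.
  (* A positive distance would force [W n] above every [K] eventually, which is excluded off a
     negligible set. *)
  rewrite leNgt; apply/negP => D0; apply: nWw => K.
  have iterE n : sigma2' k w = arch_iter (beta := beta) delta n
      (past (eps ^~ w) k) (sigma2' (k - n%:Z) w).
    elim: n => [|n ih]; first by rewrite subr0.
    by rewrite arch_iterSr -sw.
  have [/(_ Zw) gw _] := gP (past (eps ^~ w) k).
  have Hw n := Hprod_le bbeta alpha0 r01 n Zw.
  set z := fine _ `^ _ in gw Hw; have q01 := q_in01 alpha0 r01.
  set q := r `^ alpha^-1 in q01 gw Hw; have /andP[q0 q1] := q01.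
  set C := rate_const delta alpha r in gw.
  have z0 : 0 <= z by exact: powR_ge0.
  have zC0 : 0 <= C * z.
    by have := le_trans (C01B_supnorm_ge0 _ _) (gw 0%N); rewrite mulr1.
  (* If [W n <= K], the distance is at most [(z K + C z) q^n]: one term for the starting point, one
     for the convergence to [g]. *)
  have [N DN] := geometric_small (z * K%:R + C * z) q01 D0.
  exists N => n Nn; rewrite ltNge; apply/negP => WK.
  move: DN; apply/negP; rewrite -leNgt.
  apply: le_trans (supnormB_triangle _ (arch_iter (beta := beta) delta n
    (past (eps ^~ w) k) delta) _) _.
  apply: (@le_trans _ _ ((z * K%:R + C * z) * q ^+ n)).
    rewrite mulrDl; apply: lerD; last exact: gw.
    rewrite {1}(iterE n); apply: le_trans (arch_iter_lipschitz bbeta _ _ _ _ _) _.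
    rewrite mulrAC ler_pM ?(Hprod_ge0 bbeta)//; first exact: C01B_supnorm_ge0.
  have zK0 : 0 <= z * K%:R by rewrite mulr_ge0.
  by rewrite ler_wpM2l ?addr_ge0// ler_wiXn2l ?(ltW q0) ?(ltW q1).
apply: filterS2 (ey k) ae_s => w yw sw; split=> //.
by apply: C01P => t t01; rewrite yw// sw.
Qed.

Let C1 : R := (2 * rate_const delta alpha r) `^ alpha.

Lemma rate_const_gt0 : 0 < rate_const delta alpha r.
Proof.
have /andP[q0 q1] := q_in01 alpha0 r01.
by rewrite divr_gt0 ?subr_gt0// ltr_wpDl// C01_supnorm_ge0.
Qed.

Let C1_gt0 : 0 < C1.
Proof. by rewrite powR_gt0// mulr_gt0// rate_const_gt0. Qed.

(** Bounding both terms by the one with the larger of [u], [u'] costs a factor 2, and the maximum is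
    at most [u + u']; no convexity enters, so small and large [alpha] are covered alike. *)
Lemma powR_coupling (D C u u' : R) m : 0 <= D -> 0 < C -> 0 <= u -> 0 <= u' ->
  D <= C * u `^ alpha^-1 * (r `^ alpha^-1) ^+ m +
       C * u' `^ alpha^-1 * (r `^ alpha^-1) ^+ m ->
  D `^ alpha <= (2 * C) `^ alpha * r ^+ m * (u + u').
Proof.
move=> D0 C0 f0 f0' DC; have /andP[r0 r1] := r01.
set q := r `^ alpha^-1 in DC.
have q0 : 0 < q by rewrite powR_gt0.
pose v := Num.max u u'.
have v0 : 0 <= v by rewrite le_max f0.
have uv : u `^ alpha^-1 <= v `^ alpha^-1.
  by rewrite ge0_ler_powR ?invr_ge0 ?nnegrE ?(ltW alpha0)// le_max lexx.
have uv' : u' `^ alpha^-1 <= v `^ alpha^-1.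
  by rewrite ge0_ler_powR ?invr_ge0 ?nnegrE ?(ltW alpha0)// le_max lexx orbT.
have {}DC : D <= 2 * C * v `^ alpha^-1 * q ^+ m.
  apply: le_trans DC _; rewrite -!mulrA (mulr_natl _ 2) mulr2n lerD//.
    by rewrite ler_wpM2l ?(ltW C0)// ler_wpM2r ?exprn_ge0 ?(ltW q0).
  by rewrite ler_wpM2l ?(ltW C0)// ler_wpM2r ?exprn_ge0 ?(ltW q0).
apply: (@le_trans _ _ ((2 * C * v `^ alpha^-1 * q ^+ m) `^ alpha)).
  rewrite ge0_ler_powR ?(ltW alpha0) ?nnegrE//.
  exact: le_trans D0 DC.
rewrite !(powRM alpha) ?exprn_ge0 ?mulr_ge0 ?powR_ge0 ?(ltW C0) ?(ltW q0)//.
rewrite -[(v `^ _) `^ _]powRrM mulVf ?gt_eqF// powRr1//.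
have -> : (q ^+ m) `^ alpha = r ^+ m.
  rewrite -powR_mulrn ?(ltW q0)// -powRrM mulrC powRrM (q_powR alpha0 r01).
  by rewrite powR_mulrn// ltW.
rewrite mulrAC ler_wpM2l ?mulr_ge0 ?exprn_ge0 ?powR_ge0 ?(ltW r0)//.
by rewrite ge_max lerDl lerDr f0 f0'.
Qed.

(** The two sequences share their [m]-th iterate from [delta], and each limit is within its own
    geometric error of it. An infinite moment sum makes the bound trivial. *)
Lemma arch_limit_coupling (e e' : nat -> C01 R) m :
  (forall i, (i < m)%N -> e i = e' i) ->
  ((supnorm (fun t => g e t - g e' t) `^ alpha)%:E <=
   (C1 * r ^+ m)%:E * (moment_sum (b := b) alpha r e +
                       moment_sum (b := b) alpha r e'))%E.
Proof.
move=> ee'; have /andP[r0 r1] := r01.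
have K0 : 0 < C1 * r ^+ m by rewrite mulr_gt0// exprn_gt0.
have Z0 := moment_sum_ge0 (b := b) alpha r01 e.
have Z0' := moment_sum_ge0 (b := b) alpha r01 e'.
apply: (le_mul_add_fin K0 Z0 Z0') => Zoo Zoo'.
have [/(_ Zoo m) ge _] := gP e; have [/(_ Zoo' m) ge' _] := gP e'.
have Zf := ge0_fin_numE Z0; rewrite Zoo in Zf.
have Zf' := ge0_fin_numE Z0'; rewrite Zoo' in Zf'.
rewrite -(fineK Zf) -(fineK Zf') -EFinD -EFinM lee_fin.
have f0 := fine_ge0 Z0; have f0' := fine_ge0 Z0'.
rewrite -(eq_arch_iter delta delta ee') in ge'.
apply: (powR_coupling (C01B_supnorm_ge0 _ _) rate_const_gt0 f0 f0').
apply: le_trans (supnormB_triangle _ (arch_iter (beta := beta) delta m e delta) _) _.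
by rewrite (supnormB_sym (g e)); exact: (lerD ge ge').
Qed.

(** * Coupling with an independent copy *)

Section coupling.
Context {d' : measure_display} {T' : measurableType d'}.
Variables (Q : probability T' R) (p : T' -> T) (eps' : int -> T' -> C01 R).
Hypothesis pP : extension P Q p.
Hypothesis eps_copy : independent_copy Q (fun k w => eps k (p w)) eps'.

Let meps' k : measurable_fun setT (eps' k).
Proof. by have [+ _ _] := eps_copy; exact. Qed.

Let mepsp k : measurable_fun setT (fun w => eps k (p w)).
Proof. by have [mp _] := pP; exact: (measurableT_comp (meps k) mp). Qed.

Let past_box k n (J : pred nat) (B : nat -> set (C01 R)) :
    set (paths int (C01 R)) :=
  [set x | forall j, (j < n)%N -> J j -> B j (past x k j)].

Let measurable_past_box k n J B : (forall j, measurable (B j)) ->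
  measurable (past_box k n J B).
Proof.
move=> mB; have -> : past_box k n J B = \bigcap_(j in [set j | (j < n)%N && J j])
    (fun x : paths int (C01 R) => x (k - j.+1%:Z)) @^-1` B j.
  apply/seteqP; split => [x xB j /= /andP[jn Jj]|x xB j jn Jj]; first exact: xB.
  by apply: xB; rewrite /= jn.
apply: bigcap_measurableType => j _.
by rewrite -[X in measurable X]setTI; exact: measurable_coordinate.
Qed.

Let past_box_law k n J B : (forall j, measurable (B j)) ->
  (Q (trajectory (fun k w => eps k (p w)) @^-1` past_box k n J B) =
   \prod_(0 <= j < n | J j) P (eps 1%R @^-1` B j))%E.
Proof.
move=> mB; have [mp pE] := pP.
rewrite -(@iid_past _ _ _ _ _ P eps k 1 n J B eps_iid mB) -pE//.
have := measurable_trajectory meps measurableT (measurable_past_box k n J mB).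
by rewrite setTI.
Qed.

(** The coordinates below [m] come from the original and the others from the copy, so the
    probability factors: a coupled past has the law of an ordinary past. *)
Let coupled_past_law k m n B : (forall j, measurable (B j)) ->
  (Q [set w | forall j, (j < n)%N ->
        B j (coupled_past (fun l => eps l (p w)) (eps' ^~ w) k m j)] =
   \prod_(0 <= j < n) P (eps 1%R @^-1` B j))%E.
Proof.
move=> mB; have [_ lawE indE] := eps_copy.
pose J := [pred j | (j < m)%N].
rewrite (bigID J)/= -!(past_box_law k _ _ mB).
(* The block from [m] on is moved from the original to the copy, which has the same law. *)
rewrite -[X in (_ * X)%E]lawE; last exact: measurable_past_box.
rewrite -indE; [|exact: measurable_past_box|exact: measurable_past_box].
congr (Q _); apply/seteqP; split => [w Bw|w [Bw1 Bw2] j jn].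
  split=> j jn Jj; have := Bw j jn; rewrite /coupled_past.
    by rewrite Jj.
  by rewrite (negbTE Jj).
by rewrite /coupled_past; case: ifPn => jm; [exact: Bw1|exact: Bw2].
Qed.

(** Integrates [arch_limit_coupling]; each of the two moment sums has expectation at most
    [1 / (1 - rho / r)], hence the factor 2. *)
Lemma expectation_coupling k (m : nat) :
  ('E_Q[fun w => (supnorm (fun t : R => sigma2_of (fun l => eps l (p w)) k t -
     g (coupled_past (fun l => eps l (p w)) (eps' ^~ w) k m) t) `^ alpha)%R]
   <= (C1 * (2 / (1 - rho / r)) * r ^+ m)%R%:E)%E.
Proof.
pose e w := past (fun l => eps l (p w)) k.
pose e' w := coupled_past (fun l => eps l (p w)) (eps' ^~ w) k m.
have me i : measurable_fun setT (fun w => e w i) by exact: mepsp.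
have me' i : measurable_fun setT (fun w => e' w i).
  by rewrite /e' /coupled_past; case: (i < m)%N; [exact: mepsp|exact: meps'].
have K0 : 0 <= C1 * r ^+ m.
  by have /andP[r0 _] := r01; rewrite mulr_ge0 ?exprn_ge0 ?(ltW C1_gt0) ?(ltW r0).
have mZ := measurable_moment_sum bbeta me alpha r01.
have mZ' := measurable_moment_sum bbeta me' alpha r01.
have Ze : (\int[Q]_w moment_sum (b := b) alpha r (e w) <= ((1 - rho / r)^-1)%:E)%E.
  apply: (expectation_moment_sum bbeta r01 rhor (X := fun j w => e w j) me (meps 1) epsH).
  move=> n B mB; rewrite -(past_box_law k n predT mB); congr (Q _).
  by apply/seteqP; split => w Bw j jn; [move=> _; exact: Bw|exact: Bw].
have Ze' : (\int[Q]_w moment_sum (b := b) alpha r (e' w) <= ((1 - rho / r)^-1)%:E)%E.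
  apply: (expectation_moment_sum bbeta r01 rhor (X := fun j w => e' w j) me' (meps 1) epsH).
  by move=> n B mB; exact: coupled_past_law.
have Z0 w : (0 <= moment_sum (b := b) alpha r (e w))%E by exact: moment_sum_ge0.
have Z0' w : (0 <= moment_sum (b := b) alpha r (e' w))%E by exact: moment_sum_ge0.
have mD : measurable_fun setT
    (fun w => supnorm (fun t => g (e w) t - g (e' w) t) `^ alpha).
  apply: (measurableT_comp (measurable_powR alpha)).
  exact: (measurable_supnormB (measurable_arch_limit bbeta me alpha0 r01 gP)
    (measurable_arch_limit bbeta me' alpha0 r01 gP)).
rewrite unlock (mulrAC C1) (mulrC 2) mulrA.
apply: (integral_le_mul_add K0 mD (fun=> powR_ge0 _ _) mZ mZ' Z0 Z0' _ Ze Ze').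
move=> w; apply: arch_limit_coupling => i im.
by rewrite /e /e' /coupled_past im.
Qed.

End coupling.
End arch_process.

Theorem theorem2p3 (R : realType) (d : measure_display) (T : measurableType d)
    (P : probability T R) (eps : int -> T -> C01 R) (delta : C01p R)
    (b : R -> R -> R) (beta : C01p R -> C01p R) (alpha : R)
    (eps_iid : iid P eps)
    (beta_kernel : kernel_operator b beta)
    (alpha_gt0 : 0 < alpha)
    (H_moment : ('E_P[fun w => (H b (sq (eps 1 w)) `^ alpha)%R] < 1)%E) :
  exists (y : int -> T -> C01 R) (sigma2 : int -> T -> C01p R),
    [/\ stationary_arch_solution P eps delta beta y sigma2,
        forall (y' : int -> T -> C01 R) (sigma2' : int -> T -> C01p R),
          stationary_arch_solution P eps delta beta y' sigma2' ->
          forall k, {ae P, forall w, y' k w = y k w /\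
                                     sigma2' k w = sigma2 k w} &
        exists g : paths nat (C01 R) -> C01 R,
          [/\ measurable_fun setT g,
              forall k, {ae P, forall w,
                sigma2 k w = g (past (fun j => eps j w) k) :> C01 R} &
              exists r c : R, [/\ 0 < r, r < 1 &
                forall (d' : measure_display) (T' : measurableType d')
                    (Q : probability T' R) (p : T' -> T)
                    (eps' : int -> T' -> C01 R),
                  extension P Q p ->
                  independent_copy Q (fun k w => eps k (p w)) eps' ->
                  forall (k : int) (m : nat), (1 <= m)%N ->
                    ('E_Q[fun w => (supnorm (fun t : R => sigma2 k (p w) t -
                        g (coupled_past (fun j => eps j (p w))
                                        (fun j => eps' j w) k m) t) `^ alpha)%R]
                      <= (c * r ^+ m)%R%:E)%E]]].
Proof.
have [meps idX _] := eps_iid.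
set E := 'E_P[_]%E in H_moment.
have E0 : (0 <= E)%E.
  by rewrite /E unlock; apply: integral_ge0 => w _; rewrite lee_fin powR_ge0.
have Efin : E \is a fin_num by rewrite ge0_fin_numE// (lt_trans H_moment) ?ltry.
(* The midpoint lies strictly between [rho] and 1: [rho < r] bounds the moment sum, [r < 1] gives
   the geometric rate. *)
pose rho := fine E; pose r := (rho + 1) / 2.
have rho0 : 0 <= rho by rewrite fine_ge0.
have rho1 : rho < 1 by rewrite -lte_fin fineK.
have epsH : (\int[P]_w (H b (sq (eps 1 w)) `^ alpha)%:E = rho%:E)%E.
  by rewrite fineK// /E unlock.
have rhor : rho < r by rewrite /r; lra.
have r01 : 0 < r < 1 by rewrite /r; lra.
have [g gP] := arch_limit_exists beta_kernel delta alpha_gt0 r01.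
exists (fun k w => y_of g (eps ^~ w) k), (fun k w => sigma2_of g (eps ^~ w) k).
split.
- exact: (stationary_arch_solution_of eps_iid beta_kernel alpha_gt0 r01 rhor epsH gP).
- exact: (stationary_arch_solution_unique eps_iid beta_kernel alpha_gt0 r01 rhor epsH gP).
- exists (fun e => g e : C01 R); split.
  + apply: (measurable_arch_limit beta_kernel _ alpha_gt0 r01 gP) => i.
    exact: measurable_coordinate.
  + by move=> k; apply: aeW => w.
  + have /andP[r0 r1] := r01.
    (* Both constants are built from data on [P] alone, hence are fixed before the extension [Q] and
       the copy. *)
    exists r, ((2 * rate_const delta alpha r) `^ alpha * (2 / (1 - rho / r))).
    split=> // d' T' Q p eps' pP eps_copy k m _.
    exact: (expectation_coupling eps_iid beta_kernel alpha_gt0 r01 rhor epsH gP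
      pP eps_copy k m).
Qed.
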